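(* Let $a,b,c,d,\tau,\eta\in\mathbb{R}$ with $ad-bc=1$ and $b\neq 0$, and let $\xi_m\in\mathbb{R}$ be any fixed but arbitrary constant. Suppose that $f(t)$, $O_f^J(\xi)$ and $(\xi-\xi_m)^pO_f^J(\xi)$ belong to $L^1(\mathbb{R})\cap L^2(\mathbb{R})$, where $O_f^J$ is the offset linear canonical transform of $f$. Then for any fixed but arbitrary $p\in\mathbb{N}=\{0,1,2,\dots\}$, $$\int_{\mathbb{R}}(\xi-\xi_m)^{2p}\,|O_f^J(\xi)|^2\,\mathrm{d}\xi=b^{2p}\int_{\mathbb{R}}|g_\beta^{(p)}(t)|^2\,\mathrm{d}t,$$ where $g_\beta^{(p)}(t)=\frac{\mathrm{d}^p}{\mathrm{d}t^p}\left(\mathrm{e}^{-\mathrm{j}\beta t}\,\mathrm{e}^{\mathrm{j}\frac{a}{2b}t^2}f(t)\right)$ with $\beta=2\pi\sigma_m$ and $\sigma_m=\frac{\xi_m-\tau}{2\pi b}$.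
   Context: $\mathrm{j}$ denotes the imaginary unit and $f$ is a (complex-valued) signal on $\mathbb{R}$. For the parameter $J=\left[\begin{array}{cc|c}a&b&\tau\\c&d&\eta\end{array}\right]$ with real entries, $ad-bc=1$ and $b\ne0$, the offset linear canonical transform (OLCT) of $f$ is $$O_f^J(\xi)=\int_{-\infty}^{+\infty}f(t)K_J(t,\xi)\,\mathrm{d}t,\qquad K_J(t,\xi)=\frac{1}{\sqrt{\mathrm{j}2\pi b}}\,\mathrm{e}^{\mathrm{j}\left[\frac{a}{2b}t^2-\frac1b t(\xi-\tau)-\frac1b\xi(d\tau-b\eta)+\frac{d}{2b}(\xi^2+\tau^2)\right]}.$$ *)

(* Defs.v *)
From HB Require Import structures.
From mathcomp Require Import all_boot all_order all_algebra.
From mathcomp Require Import all_classical all_reals all_analysis.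
From mathcomp Require Export complex.

Set Implicit Arguments.
Unset Strict Implicit.
Unset Printing Implicit Defensive.

Import Order.TTheory GRing.Theory Num.Theory.
Import numFieldNormedType.Exports.

Local Open Scope classical_set_scope.
Local Open Scope ring_scope.
Local Open Scope complex_scope.

(** Integration, Borel measurability and differentiation in the library are for
    real-valued functions; for [F : R -> R[i]] they are taken on the real
    and imaginary parts. *)

Section ComplexValuedFunctions.
Variable R : realType.
Implicit Types (F G : R -> R[i]) (p : \bar R) (n : nat).

Definition cabs (z : R[i]) : R := ComplexField.Normc.normc z.

Definition expj (theta : R) : R[i] := cos theta +i* sin theta.

Definition cmeasurable F : Prop :=
  measurable_fun [set: measurableTypeR R]
    (fun t : measurableTypeR R => complex.Re (F t)) /\
  measurable_fun [set: measurableTypeR R]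
    (fun t : measurableTypeR R => complex.Im (F t)).

Definition cLp p F : Prop :=
  cmeasurable F /\ finite_norm lebesgue_measure p (fun t => cabs (F t)).

Definition cL1L2 F : Prop := cLp 1%:E F /\ cLp 2%:E F.

Definition cintegral F : R[i] :=
  Rintegral lebesgue_measure setT (fun t => complex.Re (F t)) +i*
  Rintegral lebesgue_measure setT (fun t => complex.Im (F t)).

Definition cderivable_n n F : Prop :=
  forall k t, (k < n)%N ->
    derivable (derive1n k (fun s : R => complex.Re (F s))) t 1 /\
    derivable (derive1n k (fun s : R => complex.Im (F s))) t 1.

Definition cderive_n n F (t : R) : R[i] :=
  derive1n n (fun s : R => complex.Re (F s)) t +i*
  derive1n n (fun s : R => complex.Im (F s)) t.

(** Elements of L^1 and L^2 are functions up to equality almost everywhere, so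
    the [n]-th derivative of such an element [F] is that of an [n] times
    differentiable representative [G] of it. For [1 <= n] there is at most one
    such [G], since it is continuous; [G := F] qualifies as soon as [F] itself
    is measurable and [n] times differentiable. *)
Definition derivable_version n F G : Prop :=
  [/\ cmeasurable G,
      {ae lebesgue_measure, forall t, G t = F t} &
      cderivable_n n G].

End ComplexValuedFunctions.

Section OLCT.
Variable R : realType.

(** The entry [c] of the parameter matrix does not occur in the kernel; it is
    constrained by [a * d - b * c = 1] only. [sqrtc] is the principal square
    root. *)
Definition olct_kernel (a b c d tau eta : R) (t xi : R) : R[i] :=
  (sqrtc ('i%C * (2 * pi * b)%:C))^-1 *
  expj (a / (2 * b) * t ^+ 2 - b^-1 * t * (xi - tau)
        - b^-1 * xi * (d * tau - b * eta)
        + d / (2 * b) * (xi ^+ 2 + tau ^+ 2)).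

Definition olct (a b c d tau eta : R) (f : R -> R[i]) (xi : R) : R[i] :=
  cintegral (fun t => f t * olct_kernel a b c d tau eta t xi).

Definition gbeta (a b beta : R) (f : R -> R[i]) (t : R) : R[i] :=
  expj (- (beta * t)) * expj (a / (2 * b) * t ^+ 2) * f t.

End OLCT.

(* Main.v *)
(** With [xi = xi_m + b w] the OLCT of [f] is, up to a unimodular factor and the
    constant [(2 pi |b|)^(-1/2)], the Fourier transform [F w] of [gbeta f].  So
    the statement says that [gbeta f] has the [p] times differentiable version
    [t |-> (2 pi)^-1 \int F w expj (t w) dw], whose [p]-th derivative is the
    inverse transform of [(i w)^p F w] by differentiation under the integral,
    and that Plancherel's identity holds for the continuous function
    [(i w)^p F w].

    Inversion and Plancherel both come from Abel summation: damping by
    [exp (- e |w|)] turns inversion into convolution with the Poisson kernel.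
    - Bessel's inequality [\int |F|^2 <= 2 pi \int |h|^2] follows from
      [Re (z conj(w)) <= (|z|^2 + |w|^2) / 2], Tonelli and Fatou.
    - Bessel applied to the damped transform of [h], and Fatou again since
      the Poisson means of a continuous [h] converge pointwise, give the
      reverse inequality.
    - Integrated over [[a, b]] the Poisson kernel is a difference of
      arctangents tending to the indicator, so both sides of the inversion
      formula have the same integral over every interval; Lebesgue's
      differentiation theorem concludes. *)

Require Import Defs.
From HB Require Import structures.
From mathcomp Require Import all_boot all_order all_algebra.
From mathcomp Require Import all_classical all_reals all_analysis.
From mathcomp Require Import measurable_realfun ring lra.

Set Implicit Arguments.
Unset Strict Implicit.
Unset Printing Implicit Defensive.

Import Order.TTheory GRing.Theory Num.Theory.
Import numFieldNormedType.Exports.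

Local Open Scope classical_set_scope.
Local Open Scope ring_scope.
Local Open Scope complex_scope.

(** * Modulus, conjugation and unimodular exponentials *)

Section ComplexNumbers.
Variable R : realType.
Implicit Types (z w : R[i]) (x y : R).

Lemma Re_mulc z w :
  complex.Re (z * w) = complex.Re z * complex.Re w - complex.Im z * complex.Im w.
Proof. by case: z; case: w. Qed.

Lemma Im_mulc z w :
  complex.Im (z * w) = complex.Re z * complex.Im w + complex.Im z * complex.Re w.
Proof. by case: z; case: w. Qed.

Lemma Re_mulZ x z : complex.Re (x%:C * z) = x * complex.Re z.
Proof. by rewrite Re_mulc /= mul0r subr0. Qed.

Lemma Im_mulZ x z : complex.Im (x%:C * z) = x * complex.Im z.
Proof. by rewrite Im_mulc /= mul0r addr0. Qed.

Lemma complex_ReIm z w :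
  complex.Re z = complex.Re w -> complex.Im z = complex.Im w -> z = w.
Proof. by case: z; case: w => /= ? ? ? ? -> ->. Qed.

Lemma cabs_ge0 z : 0 <= cabs z.
Proof. by case: z => a b; exact: sqrtr_ge0. Qed.

Lemma cabs_sqr z : cabs z ^+ 2 = complex.Re z ^+ 2 + complex.Im z ^+ 2.
Proof. by case: z => a b; rewrite /= sqr_sqrtr // addr_ge0 ?sqr_ge0. Qed.

Lemma cabsM z w : cabs (z * w) = cabs z * cabs w.
Proof. exact: ComplexField.Normc.normcM. Qed.

Lemma cabs_real x : cabs x%:C = `|x|.
Proof. by rewrite /cabs /= expr0n /= addr0 sqrtr_sqr. Qed.

Lemma cabs_conjc z : cabs (conjc z) = cabs z.
Proof. by case: z => a b; rewrite /cabs /= sqrrN. Qed.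

Lemma ler_Re_cabs z : `|complex.Re z| <= cabs z.
Proof.
rewrite -(@ler_pXn2r _ 2) ?nnegrE ?cabs_ge0 // cabs_sqr real_normK ?num_real //.
by rewrite lerDl sqr_ge0.
Qed.

Lemma ler_Im_cabs z : `|complex.Im z| <= cabs z.
Proof.
rewrite -(@ler_pXn2r _ 2) ?nnegrE ?cabs_ge0 // cabs_sqr real_normK ?num_real //.
by rewrite lerDr sqr_ge0.
Qed.

Lemma cabs_le_ReIm z : cabs z <= `|complex.Re z| + `|complex.Im z|.
Proof.
rewrite -(@ler_pXn2r _ 2) ?nnegrE ?cabs_ge0 ?addr_ge0 // cabs_sqr sqrrD.
by rewrite !real_normK ?num_real // -addrA [in leRHS]addrCA lerDr
  mulrn_wge0 // mulr_ge0.
Qed.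

Lemma Re_mul_conjc z : complex.Re (z * conjc z) = cabs z ^+ 2.
Proof. by rewrite cabs_sqr; case: z => a b /=; rewrite mulrN opprK -!expr2. Qed.

(** This is [cabs (z - w) ^+ 2 >= 0] expanded. In [bessel_abel] it separates the two copies of the
    function in a double integral. *)
Lemma Re_mul_conjc_le z w :
  complex.Re (z * conjc w) <= 2^-1 * (cabs z ^+ 2 + cabs w ^+ 2).
Proof.
rewrite !cabs_sqr; case: z => a b; case: w => c d /=.
by have := sqr_ge0 (a - c); have := sqr_ge0 (b - d); lra.
Qed.

Lemma expjD x y : expj (x + y) = expj x * expj y.
Proof.
rewrite /expj cosD sinD; apply: complex_ReIm => //=.
by rewrite addrC mulrC [X in _ + X]mulrC.
Qed.

Lemma cabs_expj x : cabs (expj x) = 1.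
Proof. by rewrite /cabs /= cos2Dsin2 sqrtr1. Qed.

Lemma conjc_expj x : conjc (expj x) = expj (- x).
Proof. by rewrite /expj /= cosN sinN. Qed.

Lemma conjcM z w : conjc (z * w) = conjc z * conjc w.
Proof. exact: rmorphM. Qed.

Lemma Re_conjc z : complex.Re (conjc z) = complex.Re z.
Proof. by case: z. Qed.

Lemma conjc_realC x : conjc x%:C = x%:C :> R[i].
Proof. by rewrite /conjc /= oppr0. Qed.

End ComplexNumbers.

(** * Dominated convergence and Fatou for real-valued functions *)

Section RealIntegrals.
Context d (T : measurableType d) (R : realType).
Variable mu : {measure set T -> \bar R}.
Implicit Types (u v : T -> R) (D : set T).

Lemma integrable_le_norm D u v : measurable D -> measurable_fun D u ->
  mu.-integrable D (EFin \o v) -> (forall x, D x -> `|u x| <= v x) ->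
  mu.-integrable D (EFin \o u).
Proof.
move=> mD mu_ iv uv; apply: (le_integrable mD _ _ iv).
  exact/measurable_EFinP.
by move=> x Dx /=; rewrite lee_fin (le_trans (uv _ Dx)) ?ler_norm.
Qed.

Lemma Rintegral_dominated_cvg D (u_ : nat -> T -> R) u v : measurable D ->
  (forall n, measurable_fun D (u_ n)) -> measurable_fun D u ->
  {ae mu, forall x, D x -> u_ n x @[n --> \oo] --> u x} ->
  mu.-integrable D (EFin \o v) ->
  (forall n x, D x -> `|u_ n x| <= v x) ->
  \int[mu]_(x in D) u_ n x @[n --> \oo] --> \int[mu]_(x in D) u x.
Proof.
move=> mD mu_ mu' cu iv uv.
have [iu _ H] := @dominated_convergence _ _ _ mu D mD (fun n => EFin \o u_ n)
  (EFin \o u) (EFin \o v) (fun n => measurableT_comp (@EFin_measurable _ _) (mu_ n))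
  ltac:(by exact/measurable_EFinP) ltac:(by apply: filterS cu => x cx Dx;
    apply: cvg_EFin; [exact: nearW | exact: cx]) iv
  ltac:(by apply: aeW => x n Dx /=; rewrite lee_fin; exact: uv).
apply: fine_cvg; rewrite fineK; first exact: H.
exact: integrable_fin_num.
Qed.

(** Fatou in the form used below: a bound uniform in [n] passes to the pointwise limit with no
    dominating function, so finiteness of the limit integral comes out as a conclusion when [M] is
    finite. *)
Lemma integral_le_cvg D (u_ : nat -> T -> R) u (M : \bar R) : measurable D ->
  (forall n, measurable_fun D (u_ n)) ->
  (forall n x, D x -> 0 <= u_ n x) ->
  (forall x, D x -> u_ n x @[n --> \oo] --> u x) ->
  (forall n, \int[mu]_(x in D) (u_ n x)%:E <= M)%E ->
  (\int[mu]_(x in D) (u x)%:E <= M)%E.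
Proof.
move=> mD mu_ u0 cu uM.
have := @fatou _ _ _ mu D mD (fun n => EFin \o u_ n)
  (fun n => measurableT_comp (@EFin_measurable _ _) (mu_ n))
  ltac:(by move=> n x Dx; rewrite /= lee_fin u0).
rewrite (_ : (\int[mu]_(x in D) _)%E = \int[mu]_(x in D) (u x)%:E)%E; last first.
  apply: eq_integral => x /[!inE] Dx.
  have cx : (fun n => (u_ n x)%:E) @ \oo --> (u x)%:E.
    by apply: cvg_EFin; [exact: nearW | exact: cu].
  by rewrite is_cvg_limn_einfE; [exact/cvg_lim | exact: cvgP cx].
(* The lower limit is the limit of the infima over tails, and each infimum is at most the first
   integral of its tail. *)
move/le_trans; apply; rewrite limn_einf_lim; apply: lime_le.
  exact: is_cvg_einfs.
apply: nearW => n; apply: le_trans (uM n).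
by apply: ereal_inf_lbound; exists n => //=.
Qed.

End RealIntegrals.

(** * Integration of complex-valued functions *)

Section ComplexMeasurability.
Context d (T : measurableType d) (R : realType).
Implicit Types F G : T -> R[i].

(* [cmeasurable] over any measurable space; needed on [R * R] for Fubini. *)
Definition cmeas F : Prop :=
  measurable_fun setT (fun t => complex.Re (F t)) /\
  measurable_fun setT (fun t => complex.Im (F t)).

Lemma cmeasM F G : cmeas F -> cmeas G -> cmeas (fun t => F t * G t).
Proof.
move=> [F1 F2] [G1 G2]; split.
- under eq_fun do rewrite Re_mulc.
  by apply: measurable_funB; exact: measurable_funM.
- under eq_fun do rewrite Im_mulc.
  by apply: measurable_funD; exact: measurable_funM.
Qed.

Lemma cmeas_conjc F : cmeas F -> cmeas (fun t => conjc (F t)).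
Proof.
move=> [F1 F2]; split.
- by rewrite (_ : (fun _ => _) = fun t => complex.Re (F t)) //;
    apply/funext => t; case: (F t).
- rewrite (_ : (fun _ => _) = fun t => - complex.Im (F t)).
    exact: measurableT_comp F2.
  by apply/funext => t; case: (F t).
Qed.

Lemma cmeas_real (u : T -> R) : measurable_fun setT u -> cmeas (fun t => (u t)%:C).
Proof. by move=> mu_; split. Qed.

Lemma cmeas_expj (u : T -> R) :
  measurable_fun setT u -> cmeas (fun t => expj (u t)).
Proof.
move=> mu_; split; apply: measurableT_comp mu_; apply: continuous_measurable_fun.
- exact: continuous_cos.
- exact: continuous_sin.
Qed.

Lemma measurable_cabs_sqr F :
  cmeas F -> measurable_fun setT (fun t => cabs (F t) ^+ 2).
Proof.
move=> [F1 F2]; under eq_fun do rewrite cabs_sqr.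
by apply: measurable_funD; exact: measurable_funX.
Qed.

Lemma measurable_cabs F : cmeas F -> measurable_fun setT (fun t => cabs (F t)).
Proof.
move=> mF; rewrite (_ : (fun _ => _) = fun t => Num.sqrt (cabs (F t) ^+ 2)).
  apply: measurableT_comp (measurable_cabs_sqr mF).
  by apply: continuous_measurable_fun; exact: sqrt_continuous.
by apply/funext => t; rewrite sqrtr_sqr ger0_norm ?cabs_ge0.
Qed.

End ComplexMeasurability.

Section ComplexIntegral.
Variable R : realType.
Implicit Types (F G h k : R -> R[i]) (c : R[i]).
Let mu := @lebesgue_measure R.

Definition cintegrable F : Prop :=
  mu.-integrable setT (EFin \o (fun t => complex.Re (F t))) /\
  mu.-integrable setT (EFin \o (fun t => complex.Im (F t))).

Lemma cintegrable_cmeasurable F : cintegrable F -> cmeasurable F.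
Proof. by move=> [/measurable_int/measurable_EFinP ? /measurable_int/measurable_EFinP]. Qed.

Lemma cmeasurable_cintegrable F (u : R -> R) : cmeasurable F ->
  mu.-integrable setT (EFin \o u) -> (forall t, cabs (F t) <= u t) ->
  cintegrable F.
Proof.
move=> [F1 F2] iu Fu; split; (apply: (integrable_le_norm _ _ iu) => //);
  move=> t _; apply: le_trans (Fu t).
- exact: ler_Re_cabs.
- exact: ler_Im_cabs.
Qed.

Lemma cintegrable_cabs F : cintegrable F ->
  mu.-integrable setT (EFin \o (fun t => cabs (F t))).
Proof.
move=> iF; have [F1 F2] := iF.
have := integrableD measurableT (integrable_abse F1) (integrable_abse F2).
move/integrable_le_norm; apply => //.
  exact: measurable_cabs (cintegrable_cmeasurable iF).
by move=> t _ /=; rewrite ger0_norm ?cabs_ge0 // cabs_le_ReIm.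
Qed.

Lemma cintegrableM F G (C : R) : cintegrable F -> cmeasurable G ->
  (forall t, cabs (G t) <= C) -> cintegrable (fun t => F t * G t).
Proof.
move=> iF mG GC.
have iC := integrableZl measurableT C (cintegrable_cabs iF).
apply: (cmeasurable_cintegrable (u := fun t => C * cabs (F t))) => //.
  exact: cmeasM (cintegrable_cmeasurable iF) mG.
by move=> t; rewrite cabsM mulrC ler_wpM2r // cabs_ge0.
Qed.

Lemma cintegrable_conjc F : cintegrable F -> cintegrable (fun t => conjc (F t)).
Proof.
move=> iF; apply: (cmeasurable_cintegrable _ (cintegrable_cabs iF)).
  exact: cmeas_conjc (cintegrable_cmeasurable iF).
by move=> t; rewrite cabs_conjc.
Qed.

Lemma eq_cintegral F G : F =1 G -> cintegral F = cintegral G.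
Proof. by move=> FG; congr cintegral; exact/funext. Qed.

Lemma cintegral_conjc F : cintegrable F ->
  cintegral (fun t => conjc (F t)) = conjc (cintegral F).
Proof.
move=> [F1 F2]; apply: complex_ReIm => /=.
  by apply: eq_Rintegral => t _; case: (F t).
rewrite -mulN1r -RintegralZl //.
by apply: eq_Rintegral => t _; rewrite mulN1r; case: (F t).
Qed.

Lemma integrableZ_real (r : R) (u : R -> R) :
  mu.-integrable setT (EFin \o u) -> mu.-integrable setT (EFin \o (fun t => r * u t)).
Proof. by move=> iu; have := integrableZl measurableT r iu. Qed.

Lemma cintegralZ c F : cintegrable F ->
  cintegral (fun t => c * F t) = c * cintegral F.
Proof.
move=> [F1 F2]; have Z := integrableZ_real.
apply: complex_ReIm; rewrite ?Re_mulc ?Im_mulc /=.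
- rewrite -!RintegralZl // -RintegralB //; [| exact: Z | exact: Z].
  by apply: eq_Rintegral => t _; rewrite Re_mulc.
- rewrite -!RintegralZl // -RintegralD //; [| exact: Z | exact: Z].
  by apply: eq_Rintegral => t _; rewrite Im_mulc.
Qed.

(** The factor 2 comes from bounding the real and imaginary parts separately. The estimate serves to
    show that Fourier transforms are bounded. *)
Lemma cabs_cintegral_le F : cintegrable F ->
  cabs (cintegral F) <= 2 * \int[mu]_t cabs (F t).
Proof.
move=> iF; have [F1 F2] := iF.
apply: le_trans (cabs_le_ReIm _) _; rewrite mulr_natl mulr2n /=.
have ic := cintegrable_cabs iF.
apply: lerD.
- apply: le_trans (le_normr_Rintegral _ F1) _ => //.
  by apply: le_Rintegral (integrable_abse F1) ic _ => // t _; exact: ler_Re_cabs.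
- apply: le_trans (le_normr_Rintegral _ F2) _ => //.
  by apply: le_Rintegral (integrable_abse F2) ic _ => // t _; exact: ler_Im_cabs.
Qed.

End ComplexIntegral.

(** * Fubini's theorem for products of integrable functions and a bounded kernel *)

Section Fubini.
Variable R : realType.
Implicit Types (h k : R -> R[i]) (E : R -> R -> R[i]).
Let mu := @lebesgue_measure R.
Let R2 := (measurableTypeR R * measurableTypeR R)%type.

(** Integrability of every section, rather than almost every one, makes [fine] lossless at each
    point, so that the real iterated integrals are the extended ones. *)
Lemma Rintegral_Fubini (u : R -> R -> R) :
  (mu \x mu)%E.-integrable setT (EFin \o (fun z : R2 => u z.1 z.2)) ->
  (forall x, mu.-integrable setT (EFin \o u x)) ->
  (forall y, mu.-integrable setT (EFin \o u ^~ y)) ->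
  mu.-integrable setT (EFin \o (fun x => \int[mu]_y u x y)) /\
  \int[mu]_x \int[mu]_y u x y = \int[mu]_y \int[mu]_x u x y.
Proof.
move=> iu i1 i2.
have E1 x : (\int[mu]_y u x y)%:E = (\int[mu]_y (u x y)%:E)%E.
  by rewrite fineK //; exact: integrable_fin_num (i1 x).
have E2 y : (\int[mu]_x u x y)%:E = (\int[mu]_x (u x y)%:E)%E.
  by rewrite fineK //; exact: integrable_fin_num (i2 y).
split.
  rewrite (_ : EFin \o _ = fubini_F mu (EFin \o (fun z : R2 => u z.1 z.2))).
    exact: integrable_fubini_F.
  by apply/funext => x /=; rewrite E1.
have := Fubini iu; rewrite /Rintegral /= => H.
congr fine.
under eq_integral do rewrite E1.
by under [in RHS]eq_integral do rewrite E2.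
Qed.

Section kernel.
Variables (h k : R -> R[i]) (E : R -> R -> R[i]) (C : R).
Hypotheses (ih : cintegrable h) (ik : cintegrable k).
Hypothesis mE : cmeas (fun z : R2 => E z.1 z.2).
Hypothesis EC : forall x y, cabs (E x y) <= C.

Let K x y := h x * (k y * E x y).

Let mE1 x : cmeasurable (E x).
Proof.
have [e1 e2] := mE.
by split; have := measurable_fun_pair2 x e1; have := measurable_fun_pair2 x e2.
Qed.

Let mE2 y : cmeasurable (E ^~ y).
Proof.
have [e1 e2] := mE.
by split; have := measurable_fun_pair1 y e1; have := measurable_fun_pair1 y e2.
Qed.

Let mK : cmeas (fun z : R2 => K z.1 z.2).
Proof.
have [h1 h2] := cintegrable_cmeasurable ih.
have [k1 k2] := cintegrable_cmeasurable ik.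
apply: cmeasM; [|apply: cmeasM mE]; split.
- exact: measurableT_comp h1 measurable_fst.
- exact: measurableT_comp h2 measurable_fst.
- exact: measurableT_comp k1 measurable_snd.
- exact: measurableT_comp k2 measurable_snd.
Qed.

Let iK1 x : cintegrable (K x).
Proof.
have := cintegrableM ik (mE1 x) (EC x) => ikE.
rewrite /K (_ : (fun y => _) = fun y => k y * E x y * h x); last first.
  by apply/funext => y; rewrite mulrC.
exact: (cintegrableM (C := cabs (h x)) ikE).
Qed.

Let iK2 y : cintegrable (K ^~ y).
Proof.
have := cintegrableM ih (mE2 y) (EC ^~ y) => ihE.
rewrite /K (_ : (fun x => _) = fun x => h x * E x y * k y); last first.
  by apply/funext => x; rewrite mulrCA mulrC.
exact: (cintegrableM (C := cabs (k y)) ihE).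
Qed.

Let KC x y : cabs (K x y) <= C * cabs (h x) * cabs (k y).
Proof.
have -> : C * cabs (h x) * cabs (k y) = cabs (h x) * (cabs (k y) * C) by ring.
by rewrite /K !cabsM !ler_wpM2l ?cabs_ge0.
Qed.

Let iK (u : R -> R -> R) : measurable_fun setT (fun z : R2 => u z.1 z.2) ->
  (forall x y, `|u x y| <= cabs (K x y)) ->
  (mu \x mu)%E.-integrable setT (EFin \o (fun z : R2 => u z.1 z.2)).
Proof.
move=> mu_ uK.
have C0 : 0 <= C by apply: le_trans (EC 0 0); exact: cabs_ge0.
apply/integrable12ltyP; first exact/measurable_EFinP.
have ia := cintegrable_cabs ik; have ja := cintegrable_cabs ih.
pose N := \int[mu]_y cabs (k y).
have N0 : 0 <= N by apply: Rintegral_ge0 => ? _; exact: cabs_ge0.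
(* By [KC] the inner integral over [y] is at most [N * C * cabs (h x)], with [N] the mass of
   [cabs k]; this is integrable in [x], so the iterated integral is finite. *)
have := integrableZl measurableT (N * C) ja.
move=> /integrableP[mm]; apply: le_lt_trans.
have mabs : measurable_fun setT (fun z : R2 => (`|u z.1 z.2|%:E)%E).
  by apply/measurable_EFinP; exact: measurableT_comp.
apply: ge0_le_integral => //.
- by move=> x _; exact: integral_ge0.
- exact: (measurable_fun_fubini_tonelli_F _ mabs).
- exact: measurableT_comp.
move=> x _ /=; rewrite ger0_norm ?mulr_ge0 ?cabs_ge0 //.
rewrite (_ : N * C * cabs (h x) = (C * cabs (h x)) * N); last by ring.
rewrite EFinM fineK; last exact: integrable_fin_num ia.
rewrite -integralZl //; apply: ge0_le_integral => //.
- apply/measurable_EFinP; apply: measurableT_comp => //.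
  by have := measurable_fun_pair2 x mu_.
- by apply: measurable_funeM; exact: measurable_int ia.
- by move=> y _; rewrite lee_fin; apply: le_trans (uK x y) (KC x y).
Qed.

(** The integrand is dominated by [C * cabs (h x) * cabs (k y)]. Two kernels are used:
    [expj (- (x * y))] for the multiplication formula, and the Poisson kernel for integrals of
    Poisson means over intervals. *)
Lemma cintegral_Fubini :
  cintegrable (fun x => h x * cintegral (fun y => k y * E x y)) /\
  cintegral (fun x => h x * cintegral (fun y => k y * E x y)) =
  cintegral (fun y => k y * cintegral (fun x => h x * E x y)).
Proof.
have -> : (fun x => h x * cintegral (fun y => k y * E x y)) =
          fun x => cintegral (K x).
  by apply/funext => x; rewrite -cintegralZ //; exact: cintegrableM ik (mE1 x) (EC x).
have -> : (fun y => k y * cintegral (fun x => h x * E x y)) =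
          fun y => cintegral (K ^~ y).
  apply/funext => y; rewrite -cintegralZ; last exact: cintegrableM ih (mE2 y) (EC ^~ y).
  by apply: eq_cintegral => x; rewrite /K mulrCA.
have [m1 m2] := mK.
have [J1 H1] := Rintegral_Fubini (iK m1 (fun x y => ler_Re_cabs (K x y)))
  (fun x => (iK1 x).1) (fun y => (iK2 y).1).
have [J2 H2] := Rintegral_Fubini (iK m2 (fun x y => ler_Im_cabs (K x y)))
  (fun x => (iK1 x).2) (fun y => (iK2 y).2).
by split; [split | rewrite /cintegral H1 H2].
Qed.

End kernel.

End Fubini.

(** * Abel and Poisson kernels *)

Section AffineSubstitution.
Variable R : realType.
Let mu := @lebesgue_measure R.

Lemma measurable_affine (m b : R) :
  measurable_fun [set: measurableTypeR R]
    ((fun x => m + b * x) : measurableTypeR R -> measurableTypeR R).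
Proof. by apply: measurable_funD => //; exact: measurable_funM. Qed.

(** By uniqueness of Lebesgue measure only half-open intervals matter; the preimage of one is an
    interval shorter by the factor [|b|], reversed if [b < 0]. The measure [nu] is given by its
    values alone, so that the result fits a pushforward whatever measurability proof it carries. *)
Lemma lebesgue_measure_affine (m b : R) : b != 0 ->
  forall nu : {measure set (measurableTypeR R) -> \bar R},
  (forall A, nu A = mu ((fun x => m + b * x)%R @^-1` A)) ->
  forall A, measurable A -> mu A = mscale (NngNum (normr_ge0 b)) nu A.
Proof.
move=> b0 nu nuE A; apply: lebesgue_measure_unique => {A} _ [[x y]] _ <-.
change (mu `]x, y]%classic = `|b|%:E * nu `]x, y]%classic)%E; rewrite nuE /mu.
have [b_gt0|b_lt0|/eqP] := ltgtP 0 b; last by rewrite eq_sym (negbTE b0).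
- have -> : (fun x => m + b * x) @^-1` `]x, y] = `](x - m) / b, (y - m) / b]%classic.
    apply/seteqP; split => z /=; rewrite !in_itv /= ltr_pdivrMr // ler_pdivlMr //;
      by move=> /andP[? ?]; apply/andP; split; lra.
  rewrite !lebesgue_measure_itv /= !lte_fin gtr0_norm //.
  rewrite ltr_pM2r ?invr_gt0 // ltrD2r.
  case: ifPn => _; last by rewrite mule0.
  by rewrite -!EFinB -EFinM; congr EFin; field.
- have -> : (fun x => m + b * x) @^-1` `]x, y] = `[(y - m) / b, (x - m) / b[%classic.
    apply/seteqP; split => z /=; rewrite !in_itv /= ltr_ndivlMr // ler_ndivrMr //;
      by move=> /andP[? ?]; apply/andP; split; lra.
  rewrite !lebesgue_measure_itv /= !lte_fin ltr0_norm //.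
  rewrite ltr_nM2r ?invr_lt0 // ltrD2r.
  case: ifPn => _; last by rewrite mule0.
  by rewrite -!EFinB -EFinM; congr EFin; field.
Qed.

Lemma ge0_integral_affine (m b : R) (f : R -> \bar R) : b != 0 ->
  measurable_fun [set: measurableTypeR R] f -> (forall x, 0 <= f x)%E ->
  (\int[mu]_x f x = `|b|%:E * \int[mu]_x f (m + b * x)%R)%E.
Proof.
move=> b0 mf f0.
pose phi : measurableTypeR R -> measurableTypeR R := fun x => m + b * x.
have := @ge0_integral_pushforward _ _ _ _ _ phi (measurable_affine m b) mu setT f
  measurableT mf (fun y _ => f0 y).
rewrite preimage_setT /comp /= => <-.
rewrite -(@ge0_integral_mscale _ _ _ _ _ measurableT (NngNum (normr_ge0 b)) _ mf) //.
- exact: measurable_affine.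
- move=> mphi; apply: eq_measure_integral => A mA _.
  exact: lebesgue_measure_affine.
Qed.

(** The reflection [x |-> - x] exchanges the positive and negative parts of [f]. *)
Lemma Rintegral_odd (f : R -> R) : mu.-integrable setT (EFin \o f) ->
  (forall x, f (- x) = - f x) -> \int[mu]_x f x = 0.
Proof.
move=> intf oddf; have mf := measurable_int _ intf.
have mp : measurable_fun [set: measurableTypeR R] (EFin \o f)^\+%E.
  exact: measurable_funepos.
have N1 : -1 != 0 :> R by rewrite oppr_eq0 oner_eq0.
rewrite /Rintegral integralE (ge0_integral_affine 0 N1 mp) //.
rewrite normrN1 mul1e [X in fine (X - _)%E](_ : _ =
  \int[mu]_x (EFin \o f)^\-%E x)%E; last first.
  apply: eq_integral => x _; rewrite add0r mulN1r.
  by rewrite funeposE funenegE /= oddf.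
rewrite subee //.
by have := integrable_fin_num measurableT (integrable_funeneg measurableT intf).
Qed.

Lemma is_derive_mull (k x : R) : is_derive x 1 (fun y => k * y) k.
Proof. by have := is_deriveZ k (is_derive_id x 1); rewrite [k%:A]mulr1. Qed.

Lemma is_derive_continuous (F f : R -> R) :
  (forall x : R, is_derive x 1 F (f x)) -> continuous F.
Proof.
move=> dF x; apply/differentiable_continuous/derivable1_diffP.
exact: (@ex_derive _ _ _ _ _ _ _ (dF x)).
Qed.

(** Evenness reduces the integral to the positive half-line. The derivative is asked for at [x > 0]
    only, with continuity at 0, because [abel e] has a corner at 0 and its antiderivatives below
    have the right derivative on that side only. *)
Lemma ge0_even_integral_FTC (f F : R -> R) (l : R) :
  (forall x, 0 <= f x) -> continuous f -> (forall x, f (- x) = f x) ->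
  (forall x : R, 0 < x -> is_derive x 1 F (f x)) -> {for 0, continuous F} ->
  F x @[x --> +oo] --> l ->
  (\int[mu]_x (f x)%:E = (2 * (l - F 0))%:E)%E.
Proof.
move=> f0 cf ef dF F0 Fl; rewrite ge0_symfun_integralT //; last first.
  by move=> x /=; rewrite ef.
rewrite -set_itvcy (ge0_continuous_FTC2y (F := F) (l := l)) ?EFinM ?EFinB //.
- exact: continuous_subspaceT.
- by move=> x x0; exact: (@ex_derive _ _ _ _ _ _ _ (dF x x0)).
- exact: cvg_at_right_filter.
- move=> x; rewrite in_itv /= andbT => x0.
  by rewrite derive1E (@derive_val _ _ _ _ _ _ _ (dF x x0)).
Qed.

End AffineSubstitution.

Section AbelKernel.
Variable R : realType.
Let mu := @lebesgue_measure R.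

Implicit Types e t u w x A B : R.

(* Abel's damping factor; its Fourier transform is [2 pi] times the Poisson
   kernel of the half-plane at height [e]. *)
Definition abel (e w : R) : R := expR (- (e * `|w|)).

Definition poisson (e u : R) : R := e / (pi * (e ^+ 2 + u ^+ 2)).

Lemma continuous_abel e : continuous (abel e).
Proof.
move=> x; apply: continuous_comp; last exact: continuous_expR.
apply: continuousN; apply: continuousM; first exact: cvg_cst.
exact: norm_continuous.
Qed.

Lemma poisson_den_gt0 e u : 0 < e -> 0 < e ^+ 2 + u ^+ 2.
Proof. by move=> e0; rewrite ltr_pwDl ?sqr_ge0 // exprn_gt0. Qed.

(** The antiderivative is the real part of [exp ((- e + i t) w) / (- e + i t)]. *)
Lemma abel_antiderivative (e t x : R) : 0 < e ->
  is_derive x 1 (fun w => expR (- e * w) *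
      ((t / (e ^+ 2 + t ^+ 2)) * sin (t * w) - (e / (e ^+ 2 + t ^+ 2)) * cos (t * w)))
    (expR (- e * x) * cos (t * x)).
Proof.
move=> e0; have D := poisson_den_gt0 t e0.
have d1 : is_derive x 1 (expR \o (fun w => - e * w)) (expR (- e * x) * - e).
  by apply: is_derive1_comp; exact: is_derive_mull.
have d2 : is_derive x 1 (sin \o (fun w => t * w)) (cos (t * x) * t).
  by apply: is_derive1_comp; exact: is_derive_mull.
have d3 : is_derive x 1 (cos \o (fun w => t * w)) (- sin (t * x) * t).
  by apply: is_derive1_comp; exact: is_derive_mull.
have d4 := is_deriveB (is_deriveZ (t / (e ^+ 2 + t ^+ 2)) d2)
  (is_deriveZ (e / (e ^+ 2 + t ^+ 2)) d3).
refine (is_derive_eq (is_deriveM d1 d4) _).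
rewrite !fctE /= /GRing.scale /=; field.
by rewrite gt_eqF.
Qed.

Lemma cvg_abel_osc (e t A B : R) : 0 < e ->
  expR (- e * w) * (A * sin (t * w) - B * cos (t * w)) @[w --> +oo] --> 0.
Proof.
move=> e0; apply/cvgr0Pnorm_le => /= r r0.
(* The oscillating factor is bounded by [|A| + |B|]; adding 1 keeps the divisor positive when both
   vanish. *)
have C0 : 0 < `|A| + `|B| + 1 by rewrite ltr_wpDl ?addr_ge0.
have : expR (- (e * w)) @[w --> +oo] --> (0 : R).
  have ew : e * w @[w --> +oo] --> +oo by apply: gt0_cvgMry.
  by have := cvg_comp _ _ ew (@cvgr_expR R).
move/cvgr0Pnorm_le => /(_ (r / (`|A| + `|B| + 1))) H.
near=> w; rewrite mulNr normrM.
have /le_trans : `|A * sin (t * w) - B * cos (t * w)| <= `|A| + `|B| + 1.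
  apply: le_trans (ler_normB _ _) _; rewrite !normrM -[leLHS]addr0.
  rewrite lerD // lerD // ler_piMr // ler_norml.
    by rewrite sin_geN1 sin_le1.
  by rewrite cos_geN1 cos_le1.
move=> le1.
rewrite -(divfK (lt0r_neq0 C0) r) ler_pM //; first last.
  exact: le1.
by near: w; apply: H; rewrite divr_gt0.
Unshelve. all: by end_near. Qed.

Lemma abel_ge0 e w : 0 <= abel e w.
Proof. exact: expR_ge0. Qed.

Lemma abel_le1 e w : 0 < e -> abel e w <= 1.
Proof. by move=> e0; rewrite -expR0 ler_expR oppr_le0 mulr_ge0 // ltW. Qed.

Lemma abelN e w : abel e (- w) = abel e w.
Proof. by rewrite /abel normrN. Qed.

Lemma measurable_abel e : measurable_fun [set: measurableTypeR R] (abel e).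
Proof. by apply: continuous_measurable_fun; exact: continuous_abel. Qed.

Lemma continuous_cosM t : continuous (fun w => cos (t * w)).
Proof.
move=> x; apply: continuous_comp; last exact: continuous_cos.
exact: (is_derive_continuous (is_derive_mull t)).
Qed.

Lemma continuous_sinM t : continuous (fun w => sin (t * w)).
Proof.
move=> x; apply: continuous_comp; last exact: continuous_sin.
exact: (is_derive_continuous (is_derive_mull t)).
Qed.

(** Adding 1 to the cosine makes the integrand nonnegative, so that the fundamental theorem applies
    before integrability is known. The antiderivative is the sum of those for the frequencies 0 and
    [t]. *)
Let integral_abel_cos1 e t : 0 < e ->
  (\int[mu]_w (abel e w * (1 + cos (t * w)))%:E =
   (2 * (e^-1 + e / (e ^+ 2 + t ^+ 2)))%:E)%E.
Proof.
move=> e0.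
pose G s w := expR (- e * w) * ((s / (e ^+ 2 + s ^+ 2)) * sin (s * w)
   - (e / (e ^+ 2 + s ^+ 2)) * cos (s * w)).
have dG s x : is_derive x 1 (G s) (expR (- e * x) * cos (s * x)).
  exact: abel_antiderivative.
have cG s : continuous (G s) by exact: (is_derive_continuous (dG s)).
have -> : (2 * (e^-1 + e / (e ^+ 2 + t ^+ 2)) = 2 * (0 + 0 - (G 0 \+ G t) 0)).
  rewrite /G /= !mulr0 sin0 cos0 expR0 !mulr0 !mulr1 !mul1r expr0n /= addr0.
  by field; rewrite !gt_eqF // poisson_den_gt0.
apply: ge0_even_integral_FTC.
- move=> w; rewrite mulr_ge0 ?abel_ge0 //.
- move=> x; apply: continuousM; first exact: continuous_abel.
  by apply: continuousD; [exact: cvg_cst | exact: continuous_cosM].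
- by move=> x; rewrite abelN mulrN cosN.
- move=> x x0; apply: (is_derive_eq (is_deriveD (dG 0 x) (dG t x))).
  by rewrite /abel gtr0_norm // mul0r cos0 mulNr -mulrDr.
- by apply: continuousD; exact: cG.
- by apply: cvgD; exact: cvg_abel_osc.
Qed.

Lemma integrable_abel e : 0 < e -> mu.-integrable setT (EFin \o abel e).
Proof.
move=> e0; have := integral_abel_cos1 0 e0.
under eq_integral do rewrite mul0r cos0.
move=> H; have i2 : mu.-integrable setT (EFin \o (fun w => abel e w * (1 + 1))).
  apply/integrableP; split.
    by apply/measurable_EFinP; apply: measurable_funM => //; exact: measurable_abel.
  under eq_integral do rewrite /= ger0_norm ?mulr_ge0 ?abel_ge0 //.
  by rewrite H ltry.
apply: (integrable_le_norm _ _ i2) => //; first exact: measurable_abel.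
by move=> w _; rewrite ger0_norm ?abel_ge0 // ler_peMr ?abel_ge0 // lerDl.
Qed.

Lemma cintegrable_abel e : 0 < e -> cintegrable (fun w => (abel e w)%:C).
Proof.
move=> e0; apply: (cmeasurable_cintegrable _ (integrable_abel e0)).
  by apply: cmeas_real; exact: measurable_abel.
by move=> w; rewrite cabs_real ger0_norm ?abel_ge0.
Qed.

Lemma cmeasurable_expjM t : cmeasurable (fun w => expj (t * w)).
Proof. by apply: cmeas_expj; exact: measurable_funM. Qed.

(** The imaginary part vanishes by oddness; the real part is extracted from [integral_abel_cos1]. *)
Lemma cintegral_abel e t : 0 < e ->
  cintegral (fun w => (abel e w)%:C * expj (t * w)) = (2 * pi * poisson e t)%:C.
Proof.
move=> e0.
have iE s : cintegrable (fun w => (abel e w)%:C * expj (s * w)).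
  apply: (cintegrableM (C := 1) (cintegrable_abel e0) (cmeasurable_expjM s)).
  by move=> w; rewrite cabs_expj.
have ReE s : (fun w => complex.Re ((abel e w)%:C * expj (s * w))) =
    fun w => abel e w * cos (s * w).
  by apply/funext => w; rewrite Re_mulc /= mul0r subr0.
have ImE s : (fun w => complex.Im ((abel e w)%:C * expj (s * w))) =
    fun w => abel e w * sin (s * w).
  by apply/funext => w; rewrite Im_mulc /= mul0r addr0.
have J s : \int[mu]_w (abel e w) + \int[mu]_w (abel e w * cos (s * w)) =
    2 * (e^-1 + e / (e ^+ 2 + s ^+ 2)).
  have [i1 _] := iE s; rewrite ReE in i1.
  rewrite -RintegralD //; last exact: integrable_abel.
  rewrite /Rintegral; under eq_integral => w _ do rewrite -[X in X + _]mulr1 -mulrDr.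
  by rewrite integral_abel_cos1.
apply: complex_ReIm => /=.
(* At frequency 0 the two integrals in [J] coincide, so [J 0] yields the integral of [abel e], which
   is then subtracted from [J t]. *)
- rewrite ReE; have JX := J 0.
  have E0 : \int[mu]_w (abel e w * cos (0 * w)) = \int[mu]_w abel e w.
    by apply: eq_Rintegral => w _; rewrite mul0r cos0 mulr1.
  rewrite E0 in JX.
  have -> : \int[mu]_w (abel e w * cos (t * w)) =
      2 * (e^-1 + e / (e ^+ 2 + t ^+ 2)) - \int[mu]_w abel e w.
    by rewrite -J addrC addKr.
  have -> : \int[mu]_w abel e w = 2^-1 * (2 * (e^-1 + e / (e ^+ 2 + 0 ^+ 2))).
    by rewrite -JX; field.
  have d0 : e ^+ 2 + t ^+ 2 != 0 by rewrite gt_eqF ?poisson_den_gt0.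
  have p0 : pi != 0 :> R by rewrite gt_eqF ?pi_gt0.
  rewrite /poisson expr0n /= addr0; move: (pi : R) p0 => P p0; field.
  by rewrite d0 p0 gt_eqF.
- rewrite ImE Rintegral_odd //; last first.
    by move=> w; rewrite abelN mulrN sinN mulrN.
  by have [_] := iE t; rewrite ImE.
Qed.

Lemma poisson_ge0 e u : 0 < e -> 0 <= poisson e u.
Proof.
by move=> e0; rewrite divr_ge0 ?mulr_ge0 ?pi_ge0 // ltW // poisson_den_gt0.
Qed.

Lemma poissonN e u : poisson e (- u) = poisson e u.
Proof. by rewrite /poisson sqrrN. Qed.

Lemma poisson_antiderivative e u : 0 < e ->
  is_derive u 1 (fun x => pi^-1 * atan (e^-1 * x)) (poisson e u).
Proof.
move=> e0.
have d1 : is_derive u 1 (atan \o (fun x => e^-1 * x)) ((1 + (e^-1 * u) ^+ 2)^-1 * e^-1).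
  by apply: is_derive1_comp; exact: is_derive_mull.
refine (is_derive_eq (is_deriveZ pi^-1 d1) _).
have d0 : e ^+ 2 + u ^+ 2 != 0 by rewrite gt_eqF ?poisson_den_gt0.
have p0 : pi != 0 :> R by rewrite gt_eqF ?pi_gt0.
rewrite /poisson /GRing.scale /=; move: (pi : R) p0 => P p0; field.
by rewrite d0 p0 gt_eqF // expr1n !mul1r.
Qed.

Lemma continuous_poisson e : 0 < e -> continuous (poisson e).
Proof.
move=> e0; rewrite (_ : poisson e = (fun=> e) \* (fun u => (pi * (e ^+ 2 + u ^+ 2))^-1)) // => x.
apply: continuousM; first exact: cvg_cst.
apply: continuousV; first by rewrite mulf_neq0 // gt_eqF ?pi_gt0 ?poisson_den_gt0.
apply: continuousM; first exact: cvg_cst.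
by apply: continuousD; [exact: cvg_cst | exact: exprn_continuous].
Qed.

Lemma measurable_poisson e : 0 < e ->
  measurable_fun [set: measurableTypeR R] (poisson e).
Proof. by move=> e0; apply: continuous_measurable_fun; exact: continuous_poisson. Qed.

Lemma integral_poisson e : 0 < e -> (\int[mu]_u (poisson e u)%:E = 1)%E.
Proof.
move=> e0.
pose F := fun x : R => pi^-1 * atan (e^-1 * x).
have -> : 1%E = (2 * (pi^-1 * (pi / 2) - F 0))%:E.
  by rewrite /F mulr0 atan0 mulr0 subr0 mulKf ?gt_eqF ?pi_gt0 // divff.
apply: ge0_even_integral_FTC.
- by move=> u; exact: poisson_ge0.
- exact: continuous_poisson.
- exact: poissonN.
- by move=> u _; exact: poisson_antiderivative.
- apply: (is_derive_continuous (f := poisson e)) => u; exact: poisson_antiderivative.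
- apply: cvgM; first exact: cvg_cst.
  have ew : e^-1 * w @[w --> +oo] --> +oo by apply: gt0_cvgMry; rewrite ?invr_gt0.
  by have := cvg_comp _ _ ew (@cvgy_atan R).
Qed.

Lemma integral_poisson_shift e x : 0 < e ->
  (\int[mu]_t (poisson e (x - t))%:E = 1)%E.
Proof.
move=> e0; rewrite -(integral_poisson e0).
rewrite (@ge0_integral_affine _ x (-1) (EFin \o poisson e)).
- by rewrite normrN1 mul1e; apply: eq_integral => t _; rewrite mulN1r.
- by rewrite oppr_eq0 oner_eq0.
- by apply/measurable_EFinP; exact: measurable_poisson.
- by move=> u; rewrite lee_fin poisson_ge0.
Qed.

Lemma Rintegral_poisson_itv e a b t : 0 < e -> a < b ->
  \int[mu]_(x in `[a, b]) poisson e (x - t) =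
  pi^-1 * atan (e^-1 * (b - t)) - pi^-1 * atan (e^-1 * (a - t)).
Proof.
move=> e0 ab.
have dF (x : R) : is_derive x 1 ((fun x => pi^-1 * atan (e^-1 * x)) \o (fun x => x - t))
    (poisson e (x - t)).
  have d1 : is_derive x 1 (fun x => x - t) 1.
    by refine (is_derive_eq (is_deriveB (is_derive_id x 1) (is_derive_cst t x 1)) _); rewrite subr0.
  refine (is_derive_eq (@is_derive1_comp _ (fun y => pi^-1 * atan (e^-1 * y)) (fun y => y - t) x _ _ (poisson_antiderivative (x - t) e0) d1) _).
  by rewrite mulr1.
have cF := is_derive_continuous dF.
rewrite /Rintegral (continuous_FTC2 ab (F := (fun x => pi^-1 * atan (e^-1 * x)) \o (fun x => x - t))) //.
- apply: continuous_subspaceT => x; apply: (@continuous_comp _ _ _ (fun y => y - t) (poisson e)); last exact: continuous_poisson.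
  by apply: continuousB; [exact: cvg_id | exact: cvg_cst].
- split.
  + by move=> x _; exact: (@ex_derive _ _ _ _ _ _ _ (dF x)).
  + by apply: cvg_at_right_filter; exact: cF.
  + by apply: cvg_at_left_filter; exact: cF.
- by move=> x _; rewrite derive1E (@derive_val _ _ _ _ _ _ _ (dF x)).
Qed.

End AbelKernel.

(** * Fourier transform and Abel summation *)

Section FourierTransform.
Variable R : realType.
Implicit Types (h k : R -> R[i]) (e t w x : R).
Let mu := @lebesgue_measure R.

Definition fourier h w : R[i] := cintegral (fun t => h t * expj (- (w * t))).

Lemma cintegrable_expj h (u : R -> R) : cintegrable h ->
  measurable_fun [set: measurableTypeR R] u ->
  cintegrable (fun t => h t * expj (u t)).
Proof.
move=> ih mu_; apply: (cintegrableM (C := 1)) => //; first exact: cmeas_expj.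
by move=> t; rewrite cabs_expj.
Qed.

Lemma cintegrable_fourier_integrand h w : cintegrable h ->
  cintegrable (fun t => h t * expj (- (w * t))).
Proof.
move=> ih; apply: cintegrable_expj => //.
by apply: measurableT_comp => //; exact: measurable_funM.
Qed.

Lemma cabs_fourier_le h w : cintegrable h ->
  cabs (fourier h w) <= 2 * \int[mu]_t cabs (h t).
Proof.
move=> ih; apply: le_trans (cabs_cintegral_le (cintegrable_fourier_integrand w ih)) _.
by under eq_Rintegral do rewrite cabsM cabs_expj mulr1.
Qed.

Let continuous_expjN (z : R[i]) t :
  continuous (fun w => complex.Re (z * expj (- (w * t)))) /\
  continuous (fun w => complex.Im (z * expj (- (w * t)))).
Proof.
have cc : continuous (fun w => cos (- (w * t))).
  by under eq_fun do rewrite cosN mulrC; exact: continuous_cosM.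
have cs : continuous (fun w => sin (- (w * t))).
  under eq_fun do rewrite mulrC -mulNr.
  exact: continuous_sinM.
split.
- under eq_fun do rewrite Re_mulc /=.
  by move=> w; apply: cvgB; apply: cvgM; [exact: cvg_cst|exact: cc|exact: cvg_cst|exact: cs].
- under eq_fun do rewrite Im_mulc /=.
  by move=> w; apply: cvgD; apply: cvgM; [exact: cvg_cst|exact: cs|exact: cvg_cst|exact: cc].
Qed.

Lemma continuous_fourier h : cintegrable h ->
  continuous (fun w => complex.Re (fourier h w)) /\
  continuous (fun w => complex.Im (fourier h w)).
Proof.
move=> ih; split=> w; apply/(@cvg_nbhsP _ R^o) => u uw.
- apply: (@Rintegral_dominated_cvg _ _ _ mu setT
    (fun n t => complex.Re (h t * expj (- (u n * t))))
    (fun t => complex.Re (h t * expj (- (w * t)))) (fun t => cabs (h t))) => //.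
  + by move=> n; exact: (cintegrable_cmeasurable (cintegrable_fourier_integrand (u n) ih)).1.
  + exact: (cintegrable_cmeasurable (cintegrable_fourier_integrand w ih)).1.
  + apply: aeW => t _; have [c _] := continuous_expjN (h t) t.
    by have := cvg_comp _ _ uw (c w).
  + exact: cintegrable_cabs.
  + by move=> n t _; apply: le_trans (ler_Re_cabs _) _; rewrite cabsM cabs_expj mulr1.
- apply: (@Rintegral_dominated_cvg _ _ _ mu setT
    (fun n t => complex.Im (h t * expj (- (u n * t))))
    (fun t => complex.Im (h t * expj (- (w * t)))) (fun t => cabs (h t))) => //.
  + by move=> n; exact: (cintegrable_cmeasurable (cintegrable_fourier_integrand (u n) ih)).2.
  + exact: (cintegrable_cmeasurable (cintegrable_fourier_integrand w ih)).2.
  + apply: aeW => t _; have [_ c] := continuous_expjN (h t) t.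
    by have := cvg_comp _ _ uw (c w).
  + exact: cintegrable_cabs.
  + by move=> n t _; apply: le_trans (ler_Im_cabs _) _; rewrite cabsM cabs_expj mulr1.
Qed.

Lemma cmeasurable_fourier h : cintegrable h -> cmeasurable (fourier h).
Proof.
by move=> /continuous_fourier[c1 c2]; split; exact: continuous_measurable_fun.
Qed.

(** The multiplication formula: Fubini for a kernel symmetric in its two variables. *)
Lemma cintegral_fourierM h k : cintegrable h -> cintegrable k ->
  cintegrable (fun t => h t * fourier k t) /\
  cintegral (fun w => fourier h w * k w) = cintegral (fun t => h t * fourier k t).
Proof.
move=> ih ik.
have mE : cmeas (fun z : measurableTypeR R * measurableTypeR R => expj (- (z.1 * z.2))).
  apply: cmeas_expj; apply: measurableT_comp => //; exact: measurable_funM.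
have E1 (x y : R) : cabs (expj (- (x * y))) <= 1 by rewrite cabs_expj.
have [i1 H] := @cintegral_Fubini _ h k (fun x y => expj (- (x * y))) _ ih ik mE E1.
split; first exact: i1.
rewrite {}H; apply: eq_cintegral => w; rewrite mulrC; congr (_ * _).
by apply: eq_cintegral => t; rewrite [w * t]mulrC.
Qed.

Lemma poisson_le e t : 0 < e -> `|poisson e t| <= (pi * e)^-1.
Proof.
move=> e0; rewrite ger0_norm ?poisson_ge0 // /poisson.
have p0 : 0 < pi :> R := pi_gt0 R.
have D := poisson_den_gt0 t e0.
rewrite ler_pdivrMr ?mulr_gt0 // invfM -mulrA [e^-1 * _]mulrCA mulKf ?gt_eqF //.
by rewrite ler_pdivlMl // expr2 lerDl sqr_ge0.
Qed.

Lemma measurable_poisson_shift e x : 0 < e ->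
  measurable_fun [set: measurableTypeR R] (fun t => poisson e (x - t)).
Proof.
move=> e0; apply: (measurableT_comp (measurable_poisson e0)).
exact: measurable_funB.
Qed.

(** The Poisson integral of [h], that is, its harmonic extension to the upper half-plane at height
    [e]. *)
Definition poisson_smooth e h x : R[i] :=
  cintegral (fun t => h t * (poisson e (x - t))%:C).

Lemma cintegrable_poissonM e h x : 0 < e -> cintegrable h ->
  cintegrable (fun t => h t * (poisson e (x - t))%:C).
Proof.
move=> e0 ih; apply: (cintegrableM (C := (pi * e)^-1)) => //.
  by apply: cmeas_real; exact: measurable_poisson_shift.
by move=> t; rewrite cabs_real poisson_le.
Qed.

(** The multiplication formula moves the transform onto [abel e w * expj (x * w)], whose transform
    at [t] is [2 * pi * poisson e (x - t)]. *)
Lemma cintegral_fourier_abel e h x : 0 < e -> cintegrable h ->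
  cintegral (fun w => fourier h w * ((abel e w)%:C * expj (x * w))) =
  (2 * pi)%:C * poisson_smooth e h x.
Proof.
move=> e0 ih.
have ik : cintegrable (fun w => (abel e w)%:C * expj (x * w)).
  apply: cintegrable_expj; first exact: cintegrable_abel.
  exact: measurable_funM.
rewrite (cintegral_fourierM ih ik).2 -cintegralZ; last exact: cintegrable_poissonM.
apply: eq_cintegral => t; rewrite mulrCA; congr (_ * _).
transitivity (2 * pi * poisson e (x - t))%:C; last by rewrite rmorphM.
rewrite -cintegral_abel //; apply: eq_cintegral => w.
by rewrite -mulrA -expjD mulrBl.
Qed.

(* The conjugate makes the forward transform of this function the conjugate of
   an inverse transform, so that no reflection [t |-> - t] is needed. *)
Definition damped_fourier e h w : R[i] := conjc (fourier h w) * (abel e w)%:C.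

Lemma cintegrable_damped_fourier e h : 0 < e -> cintegrable h ->
  cintegrable (damped_fourier e h).
Proof.
move=> e0 ih; rewrite /damped_fourier; under eq_fun do rewrite mulrC.
apply: (cintegrableM (C := 2 * \int[mu]_t cabs (h t)) (cintegrable_abel e0)).
  exact: cmeas_conjc (cmeasurable_fourier ih).
by move=> w; rewrite cabs_conjc; exact: cabs_fourier_le.
Qed.

Lemma fourier_damped_fourier e h x : 0 < e -> cintegrable h ->
  fourier (damped_fourier e h) x = conjc ((2 * pi)%:C * poisson_smooth e h x).
Proof.
move=> e0 ih.
have E w : damped_fourier e h w * expj (- (x * w)) =
    conjc (fourier h w * ((abel e w)%:C * expj (x * w))).
  by rewrite !conjcM conjc_expj conjc_realC mulrA.
rewrite -cintegral_fourier_abel // -cintegral_conjc; first exact: eq_cintegral.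
have := cintegrable_conjc (cintegrable_fourier_integrand x (cintegrable_damped_fourier e0 ih)).
by under eq_fun do rewrite E conjcK.
Qed.

End FourierTransform.

(** * Bessel and Plancherel *)

Section Bessel.
Variable R : realType.
Implicit Types (h k : R -> R[i]) (e t w x : R).
Let mu := @lebesgue_measure R.

Lemma EFin_Rintegral (u : R -> R) : mu.-integrable setT (EFin \o u) ->
  (\int[mu]_t u t)%:E = (\int[mu]_t (u t)%:E)%E.
Proof. by move=> iu; rewrite fineK //; have := integrable_fin_num measurableT iu. Qed.

Lemma integrable_poisson_shift e x : 0 < e ->
  mu.-integrable setT (EFin \o (fun t => poisson e (x - t))).
Proof.
move=> e0; apply/integrableP; split.
  by apply/measurable_EFinP; exact: measurable_poisson_shift.
under eq_integral => s _ do rewrite /= ger0_norm ?poisson_ge0 //.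
by rewrite integral_poisson_shift // ltry.
Qed.

Lemma Rintegral_poisson_shift e x : 0 < e ->
  \int[mu]_t poisson e (x - t) = 1.
Proof. by move=> e0; rewrite /Rintegral integral_poisson_shift. Qed.

Lemma integrable_poissonM e x (u : R -> R) : 0 < e ->
  mu.-integrable setT (EFin \o u) ->
  mu.-integrable setT (EFin \o (fun t => u t * poisson e (x - t))).
Proof.
move=> e0 iu.
have mu_ := measurable_int _ iu; move/measurable_EFinP in mu_.
have iv : mu.-integrable setT (EFin \o (fun t => (pi * e)^-1 * `|u t|)).
  by have := integrableZl measurableT (pi * e)^-1 (integrable_abse iu).
apply: (integrable_le_norm _ _ iv) => //.
- by apply: measurable_funM => //; exact: measurable_poisson_shift.
- by move=> t _; rewrite normrM mulrC ler_wpM2r // poisson_le.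
Qed.

(** Poisson means preserve mass: by Tonelli the integral over [x] comes first, and the kernel has
    mass one in [x] as well as in [t]. *)
Lemma Rintegral_poisson_smooth e (u : R -> R) : 0 < e ->
  mu.-integrable setT (EFin \o u) -> (forall t, 0 <= u t) ->
  mu.-integrable setT (EFin \o (fun x => \int[mu]_t (u t * poisson e (x - t)))) /\
  \int[mu]_x \int[mu]_t (u t * poisson e (x - t)) = \int[mu]_t u t.
Proof.
move=> e0 iu u0.
have mu_ := measurable_int _ iu; move/measurable_EFinP in mu_.
have mp : measurable_fun setT (fun z : measurableTypeR R * measurableTypeR R =>
    poisson e (z.1 - z.2)).
  by apply: (measurableT_comp (measurable_poisson e0)); exact: measurable_funB.
have mup : measurable_fun setT (fun z : measurableTypeR R * measurableTypeR R =>
    u z.2 * poisson e (z.1 - z.2)).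
  by apply: measurable_funM => //; exact: measurableT_comp mu_ measurable_snd.
have up0 x t : 0 <= u t * poisson e (x - t) by rewrite mulr_ge0 // poisson_ge0.
have inner t : (\int[mu]_x (u t * poisson e (x - t))%:E = (u t)%:E)%E.
  under eq_integral do rewrite EFinM.
  rewrite ge0_integralZl //; last 3 first.
  - apply/measurable_EFinP; apply: (measurableT_comp (measurable_poisson e0)).
    exact: measurable_funB.
  - by move=> x _; rewrite lee_fin poisson_ge0.
  - by rewrite lee_fin.
  rewrite -[RHS]mule1 -(integral_poisson_shift t e0); congr (_ * _)%E.
  by apply: eq_integral => x _; rewrite -poissonN opprB.
have i2 : (mu \x mu)%E.-integrable setT
    (EFin \o (fun z : measurableTypeR R * measurableTypeR R => u z.2 * poisson e (z.1 - z.2))).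
  apply/integrable21ltyP; first exact/measurable_EFinP.
  rewrite [X in (X < _)%E](_ : _ = \int[mu]_t (u t)%:E)%E; last first.
    apply: eq_integral => t _; rewrite -inner.
    by apply: eq_integral => x _; rewrite /= ger0_norm ?up0.
  have /integrableP[_] := iu.
  by under eq_integral do rewrite /= ger0_norm ?u0 //.
have i1 x : mu.-integrable setT (EFin \o (fun t => u t * poisson e (x - t))).
  exact: integrable_poissonM.
have i3 t : mu.-integrable setT (EFin \o (fun x => u t * poisson e (x - t))).
  apply/integrableP; split.
    apply/measurable_EFinP; apply: measurable_funM => //.
    by apply: (measurableT_comp (measurable_poisson e0)); exact: measurable_funB.
  under eq_integral => x _ do rewrite /= ger0_norm ?up0 //.
  by rewrite inner ltry.
have [? ->] := @Rintegral_Fubini _ (fun x t => u t * poisson e (x - t)) i2 i1 i3.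
split=> //; apply: eq_Rintegral => t _.
by rewrite /Rintegral inner.
Qed.

(** The multiplication formula turns the left-hand side into [2 * pi] times the real part of the
    double integral of [h t * conjc (h s) * poisson e (t - s)]. [Re_mul_conjc_le] splits this into
    two halves, in each of which the kernel integrates to one. *)
Lemma bessel_abel e h : 0 < e -> cintegrable h ->
  mu.-integrable setT (EFin \o (fun t => cabs (h t) ^+ 2)) ->
  (\int[mu]_w (cabs (fourier h w) ^+ 2 * abel e w)%:E <=
   (2 * pi)%:E * \int[mu]_t (cabs (h t) ^+ 2)%:E)%E.
Proof.
move=> e0 ih ih2.
have ik := cintegrable_damped_fourier e0 ih.
have [iP E] := cintegral_fourierM ih ik.
have ReE w : complex.Re (fourier h w * damped_fourier e h w) =
    cabs (fourier h w) ^+ 2 * abel e w.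
  by rewrite /damped_fourier mulrA mulrC Re_mulZ Re_mul_conjc mulrC.
have iF : mu.-integrable setT (EFin \o (fun w => cabs (fourier h w) ^+ 2 * abel e w)).
  have := cintegrableM ik (cmeasurable_fourier ih) (fun w => cabs_fourier_le w ih).
  move=> [+ _]; apply: eq_integrable => // w _; congr EFin.
  by rewrite -ReE mulrC.
rewrite -EFin_Rintegral // -EFin_Rintegral // -EFinM lee_fin.
have -> : \int[mu]_w (cabs (fourier h w) ^+ 2 * abel e w) =
    complex.Re (cintegral (fun t => h t * fourier (damped_fourier e h) t)).
  by rewrite -E; apply: eq_Rintegral => w _; rewrite ReE.
have [iu Eu] := Rintegral_poisson_smooth e0 ih2 (fun t => sqr_ge0 (cabs (h t))).
have iB := integrableZl measurableT pi (integrableD measurableT ih2 iu).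
(* The inner integral over [s] of the half containing [cabs (h t) ^+ 2] is already evaluated here;
   each of the two summands contributes [pi] times the integral of [cabs (h t) ^+ 2]. *)
apply: le_trans (_ : _ <= \int[mu]_t (pi * (cabs (h t) ^+ 2 +
  \int[mu]_s (cabs (h s) ^+ 2 * poisson e (t - s))))) _; last first.
  rewrite RintegralZl //; last by have := integrableD measurableT ih2 iu.
  rewrite RintegralD // Eu -mulr2n -[_ *+ 2]mulr_natl; by rewrite mulrA [pi * 2]mulrC.
apply: le_Rintegral => //; first by case: iP.
move=> t _; rewrite fourier_damped_fourier // conjcM conjc_realC mulrCA Re_mulZ.
rewrite [2 * pi]mulrC -mulrA ler_wpM2l ?pi_ge0 //.
rewrite -cintegral_conjc; last exact: cintegrable_poissonM.
have iq := cintegrable_conjc (cintegrable_poissonM t e0 ih).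
have iq1 : mu.-integrable setT (EFin \o (fun s =>
    complex.Re (h t * conjc (h s * (poisson e (t - s))%:C)))).
  have [] := cintegrableM (C := cabs (h t)) iq (G := fun=> h t) _ (fun=> lexx _).
    by split; exact: measurable_cst.
  by move=> + _; apply: eq_integrable => // s _; congr EFin; rewrite mulrC.
have ip1 := integrable_poisson_shift t e0.
have ip2 := integrable_poissonM t e0 ih2.
have iZ1 := integrableZl measurableT (cabs (h t) ^+ 2) ip1.
rewrite -cintegralZ //=.
apply: le_trans (_ : _ <= 2 * \int[mu]_s (2^-1 * (cabs (h t) ^+ 2 * poisson e (t - s) +
    cabs (h s) ^+ 2 * poisson e (t - s)))) _.
  rewrite ler_pM2l //; apply: le_Rintegral => //.
    by have := integrableZl measurableT 2^-1 (integrableD measurableT iZ1 ip2).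
  move=> s _; rewrite conjcM conjc_realC mulrA mulrC Re_mulZ -mulrDl mulrA mulrC.
  by rewrite ler_wpM2r ?poisson_ge0 // Re_mul_conjc_le.
rewrite RintegralZl //; last by have := integrableD measurableT iZ1 ip2.
rewrite mulVKf // RintegralD // RintegralZl //.
by rewrite Rintegral_poisson_shift // mulr1.
Qed.

Lemma cvg_abel w : abel (n.+1%:R^-1) w @[n --> \oo] --> (1 : R).
Proof.
have c : - (n.+1%:R^-1 * `|w|) @[n --> \oo] --> (0 : R).
  rewrite -oppr0; apply: cvgN; rewrite -(mul0r `|w|).
  by apply: cvgM; [exact: cvg_harmonic | exact: cvg_cst].
by have := cvg_comp _ _ c (@continuous_expR R 0); rewrite expR0.
Qed.

Lemma bessel h : cintegrable h ->
  mu.-integrable setT (EFin \o (fun t => cabs (h t) ^+ 2)) ->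
  (\int[mu]_w (cabs (fourier h w) ^+ 2)%:E <=
   (2 * pi)%:E * \int[mu]_t (cabs (h t) ^+ 2)%:E)%E.
Proof.
move=> ih ih2; have mF := cmeasurable_fourier ih.
apply: (@integral_le_cvg _ _ _ mu setT
  (fun n w => cabs (fourier h w) ^+ 2 * abel n.+1%:R^-1 w)) => //.
- move=> n; apply: measurable_funM; last exact: measurable_abel.
  exact: measurable_cabs_sqr mF.
- by move=> n w _; rewrite mulr_ge0 ?sqr_ge0 ?abel_ge0.
- move=> w _; rewrite -[X in _ --> X]mulr1; apply: cvgM; first exact: cvg_cst.
  exact: cvg_abel.
- by move=> n; apply: bessel_abel.
Qed.

Lemma integrable_fourier_sqr h : cintegrable h ->
  mu.-integrable setT (EFin \o (fun t => cabs (h t) ^+ 2)) ->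
  mu.-integrable setT (EFin \o (fun t => cabs (fourier h t) ^+ 2)).
Proof.
move=> ih ih2; apply/integrableP; split.
  by apply/measurable_EFinP; exact: measurable_cabs_sqr (cmeasurable_fourier ih).
under eq_integral => t _ do rewrite /= ger0_norm ?sqr_ge0 //.
by apply: le_lt_trans (bessel ih ih2) _; rewrite -EFin_Rintegral // -EFinM ltry.
Qed.

End Bessel.

Section Plancherel.
Variable R : realType.
Implicit Types (h k : R -> R[i]) (e t w x : R).
Let mu := @lebesgue_measure R.

(* The second bound has an integrable right-hand side of mass [2 e / d]; it
   controls the mass of the kernel outside [[- d, d]] without splitting integrals. *)
Lemma poisson_le_far e d v : 0 < e -> 0 < d -> d <= `|v| ->
  poisson e v <= e / (pi * d ^+ 2) /\ poisson e v <= 2 * e / d * poisson d v.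
Proof.
move=> e0 d0 dv; have p0 : 0 < pi :> R := pi_gt0 R.
have d2v : d ^+ 2 <= v ^+ 2 by rewrite -[v ^+ 2]real_normK ?num_real // ler_pXn2r ?nnegrE ?(ltW d0).
have d2 : 0 < d ^+ 2 by rewrite exprn_gt0.
have De := poisson_den_gt0 v e0; have Dd := poisson_den_gt0 v d0.
have e2 := sqr_ge0 e.
rewrite /poisson; split.
- rewrite ler_pM2l // lef_pV2 ?posrE ?mulr_gt0 // ler_pM2l //; lra.
- have -> : 2 * e / d * (d / (pi * (d ^+ 2 + v ^+ 2))) = e * (pi * ((d ^+ 2 + v ^+ 2) / 2))^-1.
    move: (pi : R) p0 => P p0; field.
    by rewrite !gt_eqF.
  rewrite ler_pM2l // lef_pV2 ?posrE ?mulr_gt0 ?divr_gt0 // ler_pM2l //.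
  rewrite ler_pdivrMr //; lra.
Qed.

(** The Poisson kernel is an approximate identity at a point of continuity. Unit mass brings [u x]
    under the integral; continuity controls [|x - t| < d], and the two bounds of [poisson_le_far]
    control the rest, one for [u t] and one for [u x]. *)
Lemma cvg_Rintegral_poisson (u : R -> R) x :
  mu.-integrable setT (EFin \o u) -> u t @[t --> x] --> u x ->
  \int[mu]_t (u t * poisson n.+1%:R^-1 (x - t)) @[n --> \oo] --> u x.
Proof.
move=> iu cu; apply/cvgrPdist_le => /= r r0.
have r20 : 0 < r / 2 by rewrite divr_gt0.
have [d /= d0 near_x] : exists2 d : R, 0 < d & forall t, `|x - t| < d -> `|u x - u t| <= r / 2.
  move/cvgrPdist_le : cu => /(_ _ r20)/nbhs_ballP[d d0 H].
  by exists d => // t xt; exact: (H t xt).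
pose N := \int[mu]_t `|u t|.
have iN : mu.-integrable setT (EFin \o (fun t => `|u t|)) := integrable_abse iu.
(* Chosen so that [e * C] is the integral of the far majorant: the uniform bound times the mass [N]
   of [|u|], plus [|u x| * (2 * e / d)] times the unit mass of [poisson d]. *)
pose C := N / (pi * d ^+ 2) + `|u x| * 2 / d.
have p0 : 0 < pi :> R := pi_gt0 R.
have N0 : 0 <= N by apply: Rintegral_ge0.
have cvgC : n.+1%:R^-1 * C @[n --> \oo] --> (0 : R).
  by rewrite -(mul0r C); apply: cvgM; [exact: cvg_harmonic|exact: cvg_cst].
move/cvgr0Pnorm_le : cvgC => /(_ _ r20) nearC.
near=> n.
have eC : n.+1%:R^-1 * C <= r / 2.
  by apply: le_trans (ler_norm _) _; near: n; exact: nearC.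
have e0 : 0 < n.+1%:R^-1 :> R by rewrite invr_gt0.
set e : R := n.+1%:R^-1 in eC e0 *.
have i1 := integrable_poisson_shift x e0.
have i2 := integrable_poisson_shift x d0.
have i3 := integrable_poissonM x e0 iu.
have i4 := integrableZl measurableT (u x) i1.
have b1 := integrableZl measurableT (r / 2) i1.
have b2 := integrableZl measurableT (e / (pi * d ^+ 2)) iN.
have b3 := integrableZl measurableT (`|u x| * (2 * e / d)) i2.
have -> : u x - \int[mu]_t (u t * poisson e (x - t)) =
    \int[mu]_t (u x * poisson e (x - t) - u t * poisson e (x - t)).
  by rewrite RintegralB // (RintegralZl _ measurableT i1) Rintegral_poisson_shift // mulr1.
apply: le_trans (le_normr_Rintegral _ _) _ => //.
  by have := integrableB measurableT i4 i3.
(* A single majorant, the sum of the near and far ones, is valid on the whole line. *)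
apply: (@le_trans _ _ (\int[mu]_t (r / 2 * poisson e (x - t) +
   (e / (pi * d ^+ 2) * `|u t| + `|u x| * (2 * e / d) * poisson d (x - t))))).
  apply: le_Rintegral => //.
  - by have := integrable_abse (integrableB measurableT i4 i3).
  - by have := integrableD measurableT b1 (integrableD measurableT b2 b3).
  move=> t _; rewrite -mulrBl normrM [`|poisson _ _|]ger0_norm ?poisson_ge0 //.
  have [xt|xt] := ltP `|x - t| d.
    apply: le_trans (ler_wpM2r (poisson_ge0 _ e0) (near_x t xt)) _.
    rewrite lerDl addr_ge0 //.
      by rewrite mulr_ge0 // divr_ge0 ?mulr_ge0 ?sqr_ge0 // ltW.
    rewrite mulr_ge0 ?poisson_ge0 // mulr_ge0 // divr_ge0 ?mulr_ge0 //; exact: ltW.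
  have [f1 f2] := poisson_le_far e0 d0 xt.
  have q0 := poisson_ge0 (x - t) e0.
  apply: le_trans (_ : _ <= `|u t| * poisson e (x - t) + `|u x| * poisson e (x - t)) _.
    by rewrite -mulrDl ler_wpM2r // [leRHS]addrC ler_normB.
  apply: (@le_trans _ _ (0 + (e / (pi * d ^+ 2) * `|u t| + `|u x| * (2 * e / d) * poisson d (x - t)))).
    rewrite add0r lerD //; first by rewrite mulrC ler_wpM2r.
    by rewrite -mulrA ler_wpM2l.
  by rewrite lerD2r mulr_ge0 // divr_ge0 // ltW.
rewrite RintegralD //; last by have := integrableD measurableT b2 b3.
rewrite RintegralD // (RintegralZl _ measurableT i1) (RintegralZl _ measurableT i2).
rewrite (RintegralZl _ measurableT iN) !Rintegral_poisson_shift // -/N !mulr1.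
apply: le_trans (_ : _ <= r / 2 + r / 2) _; last by rewrite -splitr.
rewrite lerD2l (le_trans _ eC) // le_eqVlt; apply/orP; left; apply/eqP.
by rewrite /C; ring.
Unshelve. all: by end_near. Qed.

Lemma plancherel h : cintegrable h ->
  mu.-integrable setT (EFin \o (fun t => cabs (h t) ^+ 2)) ->
  continuous (fun t => complex.Re (h t)) -> continuous (fun t => complex.Im (h t)) ->
  (\int[mu]_w (cabs (fourier h w) ^+ 2)%:E =
   (2 * pi)%:E * \int[mu]_t (cabs (h t) ^+ 2)%:E)%E.
Proof.
move=> ih ih2 cRe cIm; apply/eqP; rewrite eq_le bessel //=.
have iF2 := integrable_fourier_sqr ih ih2.
have pi2 : 0 < 2 * pi :> R by rewrite mulr_gt0 ?pi_gt0.
(* Transforming the damped transform gives [2 * pi] times a Poisson mean up to conjugation, hence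
   the square on the left. Bessel supplies the factor on the right, and damping only decreases the
   modulus. Dividing by [2 * pi] gives the reverse of [bessel]. *)
suff H : (\int[mu]_t ((2 * pi) ^+ 2 * cabs (h t) ^+ 2)%:E <=
    (2 * pi)%:E * \int[mu]_w (cabs (fourier h w) ^+ 2)%:E)%E.
  move: H; rewrite -(EFin_Rintegral iF2) -(EFin_Rintegral ih2).
  rewrite -(EFin_Rintegral (integrableZ_real _ ih2)) RintegralZl // -!EFinM !lee_fin.
  by rewrite expr2 -mulrA ler_pM2l.
pose s n t := cabs (fourier (damped_fourier n.+1%:R^-1 h) t) ^+ 2.
have e0 n : 0 < n.+1%:R^-1 :> R by rewrite invr_gt0.
have sE n t : s n t = (2 * pi) ^+ 2 * cabs (poisson_smooth n.+1%:R^-1 h t) ^+ 2.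
  rewrite /s fourier_damped_fourier // cabs_conjc cabsM cabs_real exprMn.
  by rewrite ger0_norm // ltW.
apply: (@integral_le_cvg _ _ _ mu setT s) => //.
- move=> n; apply: measurable_cabs_sqr; apply: cmeasurable_fourier.
  exact: cintegrable_damped_fourier.
- by move=> n t _; exact: sqr_ge0.
- move=> t _; have [i1 i2] := ih.
  have ReS e : complex.Re (poisson_smooth e h t) = \int[mu]_s (complex.Re (h s) * poisson e (t - s)).
    by apply: eq_Rintegral => y _; rewrite mulrC Re_mulZ mulrC.
  have ImS e : complex.Im (poisson_smooth e h t) = \int[mu]_s (complex.Im (h s) * poisson e (t - s)).
    by apply: eq_Rintegral => y _; rewrite mulrC Im_mulZ mulrC.
  under eq_cvg do rewrite sE cabs_sqr ReS ImS.
  have c1 := cvg_Rintegral_poisson i1 (cRe t).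
  have c2 := cvg_Rintegral_poisson i2 (cIm t).
  apply: cvgM; first exact: cvg_cst.
  by rewrite cabs_sqr; apply: cvgD; [exact: (cvgM c1 c1)|exact: (cvgM c2 c2)].
- move=> n; have ik := cintegrable_damped_fourier (e0 n) ih.
  have kF t : cabs (damped_fourier n.+1%:R^-1 h t) ^+ 2 <= cabs (fourier h t) ^+ 2.
    rewrite /damped_fourier cabsM cabs_conjc cabs_real ger0_norm ?abel_ge0 //.
    by rewrite exprMn ler_piMr ?sqr_ge0 // exprn_ile1 ?abel_ge0 ?abel_le1.
  have mk := measurable_cabs_sqr (cintegrable_cmeasurable ik).
  have ik2 : mu.-integrable setT (EFin \o (fun t => cabs (damped_fourier n.+1%:R^-1 h t) ^+ 2)).
    apply: (integrable_le_norm _ _ iF2) => // t _.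
    by rewrite ger0_norm ?sqr_ge0.
  apply: le_trans (bessel ik ik2) _.
  rewrite -(EFin_Rintegral iF2) -(EFin_Rintegral ik2) -!EFinM lee_fin.
  by rewrite ler_pM2l // le_Rintegral.
Qed.

End Plancherel.

(** * Fourier inversion *)

Section Inversion.
Variable R : realType.
Implicit Types (g h k : R -> R[i]) (a b e t w x : R).
Let mu := @lebesgue_measure R.

Lemma locally_integrable_itv (v : R -> R) (a b : R) :
  locally_integrable setT v -> mu.-integrable `[a, b] (EFin \o v).
Proof.
move=> [mv _ iv]; apply/integrableP; split.
  by apply/measurable_EFinP; exact: measurable_funTS.
by have := iv `[a, b]%classic (@subsetT _ _) (@segment_compact _ a b).
Qed.

Lemma continuous_locally_integrable (v : R -> R) :
  continuous v -> locally_integrable setT v.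
Proof.
move=> cv; split; [exact: continuous_measurable_fun|exact: openT|].
move=> K _ cK; have /integrableP[_] // := continuous_compact_integrable cK (continuous_subspaceT cv).
Qed.

(** By Lebesgue differentiation, almost every [x > - n] is a point where [y |-> \int_(- n)^y v] has
    derivative [v x]; that function is identically 0. The line is the union of these half-lines. *)
Lemma locally_integrable_ae_eq0 (v : R -> R) : locally_integrable setT v ->
  (forall a b, a < b -> \int[mu]_(t in `[a, b]) v t = 0) ->
  {ae mu, forall t, v t = 0}.
Proof.
move=> lv v0.
have ae0 (n : nat) : {ae mu, forall x, - n%:R < x -> v x = 0}.
  have iv y : mu.-integrable [set` Interval (BLeft (- n%:R)) (BRight y)] (EFin \o v).
    exact: locally_integrable_itv.
  have := FTC1 iv lv.
  apply: filterS; first exact: (ae_filter_ringOfSetsType mu).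
  move=> x /= H nx.
  have [_ <-] := H nx.
  rewrite (_ : (fun y => _) = cst 0); first by rewrite derive1_cst.
  apply/funext => y /=.
  have [ny|yn|<-] := ltgtP (- n%:R) y; first exact: v0.
    by rewrite set_itv_ge ?bnd_simp -?ltNge // Rintegral_set0.
  by rewrite set_itv1 Rintegral_set1.
have := negligible_bigcup ae0; apply: negligibleS => x /= vx.
(* This natural number exceeds [|x|], so its opposite lies below [x]. *)
exists (Num.truncn `|x|).+1 => //= H; apply: vx; apply: H.
rewrite ltrNl; apply: le_lt_trans (ler_norm _) _; rewrite normrN.
exact: truncnS_gt.
Qed.

(** If the functions differ at a point, they differ on a ball around it, which has positive
    measure. *)
Lemma continuous_ae_eq (u v : R -> R) : continuous u -> continuous v ->
  {ae mu, forall t, u t = v t} -> u = v.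
Proof.
move=> cu cv [N [mN N0 uvN]]; apply/funext => x; apply/eqP; rewrite -subr_eq0.
apply/negP => /negP uvx.
have cw : (fun t => u t - v t) @ x --> u x - v x by apply: cvgB; [exact: cu|exact: cv].
have /nbhs_ballP[d /= d0 H] : \forall t \near x, u t - v t != 0.
  exact: (cvgr_neq0 _ cw uvx).
have : ball x d `<=` N.
  move=> t xt; apply: uvN => /= uvt; have := H t xt; rewrite uvt subrr eqxx //.
move/(le_measure mu); rewrite !inE => /(_ (measurable_ball _ _) mN).
have B : mu (ball x d) = (d *+ 2)%:E by apply: lebesgue_measure_ball; exact: ltW.
move=> le0; have : ((d *+ 2)%:E <= 0)%E by rewrite -N0 -B; exact: le0.
by rewrite lee_fin leNgt pmulrn_lgt0 // d0.
Qed.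

(** The inverse transform, expressed through [fourier] so that continuity, linearity and Plancherel
    transfer by reflection. *)
Definition ifourier h t : R[i] := ((2 * pi)^-1)%:C * fourier h (- t).

Lemma continuous_ifourier h : cintegrable h ->
  continuous (fun t => complex.Re (ifourier h t)) /\
  continuous (fun t => complex.Im (ifourier h t)).
Proof.
move=> /continuous_fourier[c1 c2].
have cN (t : R) : - s @[s --> t] --> - t by apply: cvgN; exact: cvg_id.
split=> t; [under eq_fun do rewrite /ifourier Re_mulZ|under eq_fun do rewrite /ifourier Im_mulZ];
  (apply: cvgM; first exact: cvg_cst).
- by have := cvg_comp _ _ (cN t) (c1 (- t)).
- by have := cvg_comp _ _ (cN t) (c2 (- t)).
Qed.

Lemma cvg_atan_scaled (c : R) : c != 0 ->
  atan (n.+1%:R * c) @[n --> \oo] --> (if 0 < c then pi / 2 else - (pi / 2)).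
Proof.
have P (r : R) : 0 < r -> atan (n.+1%:R * r) @[n --> \oo] --> pi / 2.
  move=> r0; have cn : (n.+1%:R : R) @[n --> \oo] --> +oo.
    by have := @cvgr_idn R; rewrite -(cvg_shiftS (fun n => n%:R : R)).
  have cr : x * r @[x --> +oo] --> +oo by apply: gt0_cvgMly.
  by have := cvg_comp _ _ (cvg_comp _ _ cn cr) (@cvgy_atan R).
move=> c0; have [cp|cn|/eqP] := ltgtP 0 c; last by rewrite eq_sym (negbTE c0).
  exact: P.
have -> : (fun n => atan (n.+1%:R * c)) = (fun n => - atan (n.+1%:R * - c)).
  by apply/funext => n; rewrite mulrN atanN opprK.
by apply: cvgN; apply: P; rewrite oppr_gt0.
Qed.

(** The integral of [poisson n.+1%:R^-1 (x - t)] over [x] in [[a, b]], in the closed form of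
    [Rintegral_poisson_itv]. *)
Let poisson_itv a b n t : R :=
  pi^-1 * atan (n.+1%:R * (b - t)) - pi^-1 * atan (n.+1%:R * (a - t)).

Let poisson_itv_le1 a b n t : `|poisson_itv a b n t| <= 1.
Proof.
have p0 : 0 < pi :> R := pi_gt0 R.
rewrite /poisson_itv -mulrBr normrM gtr0_norm ?invr_gt0 // ler_pdivrMl // mulr1.
have := atan_gtNpi2 (n.+1%:R * (b - t)); have := atan_ltpi2 (n.+1%:R * (b - t)).
have := atan_gtNpi2 (n.+1%:R * (a - t)); have := atan_ltpi2 (n.+1%:R * (a - t)).
move: (pi : R) p0 (atan _) (atan _) => P p0 A B *; rewrite ler_norml; apply/andP; split; lra.
Qed.

(** Each arctangent tends to plus or minus [pi / 2] according to the side on which [t] lies. The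
    endpoints are excluded because the limit there is one half. *)
Let cvg_poisson_itv a b t : a < b -> t != a -> t != b ->
  poisson_itv a b n t @[n --> \oo] --> (\1_(`[a, b]%classic : set R) t : R).
Proof.
move=> ab ta tb; have p0 : pi != 0 :> R by rewrite gt_eqF ?pi_gt0.
have cb := @cvg_atan_scaled (b - t); rewrite subr_eq0 eq_sym in cb.
have ca := @cvg_atan_scaled (a - t); rewrite subr_eq0 eq_sym in ca.
have H := cvgB (cvgM (cvg_cst pi^-1) (cb tb)) (cvgM (cvg_cst pi^-1) (ca ta)).
suff E : pi^-1 * (if 0 < b - t then pi / 2 else - (pi / 2)) -
    pi^-1 * (if 0 < a - t then pi / 2 else - (pi / 2)) =
    \1_(`[a, b]%classic : set R) t :> R by rewrite -E; exact: H.
rewrite !subr_gt0 indicE mem_setE in_itv /=.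
have -> : (a <= t <= b) = (a < t < b) by rewrite !lt_neqAle tb eq_sym ta.
have [tb'|tb'|/eqP] := ltgtP t b; last by rewrite (negbTE tb).
  have [ta'|ta'|/eqP] := ltgtP t a; last by rewrite (negbTE ta).
    by rewrite subrr.
  by rewrite mulrN opprK -mulrDr -splitr mulVf.
have -> : (t < a) = false by apply/negbTE; rewrite -leNgt ltW // (lt_trans ab).
by rewrite subrr andbF.
Qed.

(** Fubini with the indicator of [[a, b]] as one of the two integrable factors. *)
Let Rintegral_poisson_smooth_itv a b n g : a < b -> cintegrable g ->
  \int[mu]_(x in `[a, b]) complex.Re (poisson_smooth n.+1%:R^-1 g x) =
  \int[mu]_t (complex.Re (g t) * poisson_itv a b n t).
Proof.
move=> ab ig; have e0 : 0 < n.+1%:R^-1 :> R by rewrite invr_gt0.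
set e : R := n.+1%:R^-1 in e0 *.
pose I : R -> R := \1_(`[a, b]%classic : set R).
have mI : measurable_fun [set: measurableTypeR R] I by exact: measurable_indic.
have iI : cintegrable (fun x => (I x)%:C).
  have i1 : mu.-integrable setT (EFin \o I).
    rewrite (_ : EFin \o I = (EFin \o cst 1) \_ (`[a, b]%classic : set R)).
      apply/integrable_restrict => //; rewrite setTI.
      by apply: continuous_compact_integrable; [exact: segment_compact|exact: cst_continuous].
    by apply/funext => x; rewrite /= /I indicE patchE; case: ifPn.
  apply: (cmeasurable_cintegrable _ i1); first exact: cmeas_real.
  by move=> x; rewrite cabs_real ger0_norm // /I indicE.
have mE : cmeas (fun z : measurableTypeR R * measurableTypeR R => (poisson e (z.1 - z.2))%:C).
  apply: cmeas_real; apply: (measurableT_comp (measurable_poisson e0)).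
  exact: measurable_funB.
have EC (x t : R) : cabs (poisson e (x - t))%:C <= (pi * e)^-1.
  by rewrite cabs_real poisson_le.
have [_ H] := @cintegral_Fubini _ _ g (fun x t => (poisson e (x - t))%:C) _ iI ig mE EC.
transitivity (complex.Re (cintegral (fun x => (I x)%:C * poisson_smooth e g x))).
  rewrite Rintegral_mkcond; apply: eq_Rintegral => x _.
  by rewrite Re_mulZ /I indicE patchE; case: ifPn => _; rewrite ?mul1r ?mul0r.
rewrite {}H; apply: eq_Rintegral => t _; rewrite Re_mulc.
have -> : complex.Re (cintegral (fun x => (I x)%:C * (poisson e (x - t))%:C)) = poisson_itv a b n t.
  rewrite /poisson_itv -[n.+1%:R]invrK -Rintegral_poisson_itv // Rintegral_mkcond.
  apply: eq_Rintegral => x _.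
  by rewrite Re_mulZ /I indicE patchE; case: ifPn => _; rewrite ?mul1r ?mul0r.
have -> : complex.Im (cintegral (fun x => (I x)%:C * (poisson e (x - t))%:C)) = 0.
  transitivity (\int[mu]_(x in setT) (0 : R)); last by rewrite Rintegral_cst // mul0r.
  by apply: eq_Rintegral => x _; rewrite Im_mulZ mulr0.
by rewrite mulr0 subr0.
Qed.

Let cvg_Rintegral_smooth_itv a b g : a < b -> cintegrable g ->
  \int[mu]_(x in `[a, b]) complex.Re (poisson_smooth n.+1%:R^-1 g x) @[n --> \oo] -->
  \int[mu]_(t in `[a, b]) complex.Re (g t).
Proof.
move=> ab ig; under eq_cvg do rewrite Rintegral_poisson_smooth_itv //.
rewrite Rintegral_mkcond.
have mg := (cintegrable_cmeasurable ig).1.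
have mI (c : R) n : measurable_fun [set: measurableTypeR R]
    (fun t : R => pi^-1 * atan (n.+1%:R * (c - t))).
  apply: measurable_funM => //; apply: measurableT_comp.
    apply: continuous_measurable_fun; exact: continuous_atan.
  by apply: measurable_funM => //; exact: measurable_funB.
apply: (@Rintegral_dominated_cvg _ _ _ mu setT
  (fun n t => complex.Re (g t) * poisson_itv a b n t) _ (fun t => cabs (g t))) => //.
- by move=> n; apply: measurable_funM => //; exact: measurable_funB.
- by apply/(measurable_restrictT _ _).1 => //; exact: measurable_funTS.
(* Pointwise convergence can fail only at the two endpoints, a null set. *)
- exists [set a; b]; split.
  + exact: measurableU.
  + by apply: countable_lebesgue_measure0; apply: finite_set_countable; exact: finite_set2.
  + move=> t /= H; apply: contrapT => /not_orP[/eqP ta /eqP tb]; apply: H => _.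
    have := cvgM (cvg_cst (complex.Re (g t))) (cvg_poisson_itv ab ta tb).
    rewrite patchE indicE; case: ifPn => _; rewrite ?mulr1 ?mulr0 => H; exact: H.
- exact: cintegrable_cabs.
- by move=> n t _; rewrite normrM (le_trans _ (ler_Re_cabs (g t))) // ler_piMr // poisson_itv_le1.
Qed.

Let Re_smoothE e g x : 0 < e -> cintegrable g -> cintegrable (fourier g) ->
  complex.Re (poisson_smooth e g x) =
  (2 * pi)^-1 * \int[mu]_w (abel e w * complex.Re (fourier g w * expj (x * w))).
Proof.
move=> e0 ig iF; have p0 : 2 * pi != 0 :> R by rewrite mulf_neq0 ?gt_eqF ?pi_gt0.
have := congr1 (@complex.Re R) (cintegral_fourier_abel x e0 ig).
rewrite Re_mulZ => E; apply: (mulfI p0); rewrite -E mulrA divff // mul1r.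
by apply: eq_Rintegral => w _; rewrite mulrCA Re_mulZ.
Qed.

Lemma Re_ifourierE g x :
  complex.Re (ifourier g x) =
  (2 * pi)^-1 * \int[mu]_w complex.Re (g w * expj (x * w)).
Proof.
rewrite /ifourier Re_mulZ; congr (_ * _).
by apply: eq_Rintegral => w _; rewrite mulNr opprK.
Qed.

(** Both sides are limits of the same integrals of Poisson means over [[a, b]]. For the left-hand
    side dominated convergence is used twice: in [w] with majorant [cabs (fourier g w)], then in [x]
    with a constant majorant. *)
Let Rintegral_itv_inversion a b g : a < b -> cintegrable g -> cintegrable (fourier g) ->
  \int[mu]_(x in `[a, b]) complex.Re (ifourier (fourier g) x) =
  \int[mu]_(x in `[a, b]) complex.Re (g x).
Proof.
move=> ab ig iF; apply/esym.
have e0 n : 0 < n.+1%:R^-1 :> R by rewrite invr_gt0.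
apply: (cvg_unique _ (cvg_Rintegral_smooth_itv ab ig)) => //.
have iFe x : cintegrable (fun w => fourier g w * expj (x * w)).
  by apply: cintegrable_expj => //; exact: measurable_funM.
pose M := \int[mu]_w cabs (fourier g w).
have bound n x w : `|abel n.+1%:R^-1 w * complex.Re (fourier g w * expj (x * w))| <= cabs (fourier g w).
  rewrite normrM ger0_norm ?abel_ge0 // -[leRHS]mul1r ler_pM ?abel_ge0 ?abel_le1 //.
  by apply: le_trans (ler_Re_cabs _) _; rewrite cabsM cabs_expj mulr1.
have iM := cintegrable_cabs iF.
apply: (@Rintegral_dominated_cvg _ _ _ mu `[a, b]%classic
  (fun n x => complex.Re (poisson_smooth n.+1%:R^-1 g x)) _ (cst ((2 * pi)^-1 * M))) => //.
- move=> n; apply: measurable_funTS.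
  (* Measurability comes from recognising a Poisson mean as a Fourier transform, up to conjugation
     and a constant. *)
  have -> : (fun x => complex.Re (poisson_smooth n.+1%:R^-1 g x)) =
      fun x => (2 * pi)^-1 * complex.Re (fourier (damped_fourier n.+1%:R^-1 g) x).
    apply/funext => x; rewrite fourier_damped_fourier // conjcM conjc_realC Re_mulZ.
    by rewrite mulrA mulVf ?mul1r ?Re_conjc ?mulf_neq0 ?gt_eqF ?pi_gt0.
  apply: measurable_funM => //.
  by have [] := cmeasurable_fourier (cintegrable_damped_fourier (e0 n) ig).
- apply: measurable_funTS; apply: continuous_measurable_fun.
  by have [] := continuous_ifourier iF.
- apply: aeW => x _; under eq_cvg do rewrite Re_smoothE //.
  rewrite Re_ifourierE; apply: cvgM; first exact: cvg_cst.
  apply: (@Rintegral_dominated_cvg _ _ _ mu setT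
    (fun n w => abel n.+1%:R^-1 w * complex.Re (fourier g w * expj (x * w))) _
    (fun w => cabs (fourier g w))) => //.
  + move=> n; apply: measurable_funM; first exact: measurable_abel.
    exact: (cintegrable_cmeasurable (iFe x)).1.
  + exact: (cintegrable_cmeasurable (iFe x)).1.
  + apply: aeW => w _; rewrite -[X in _ --> X]mul1r.
    by apply: cvgM; [exact: cvg_abel|exact: cvg_cst].
- by apply: continuous_compact_integrable; [exact: segment_compact|exact: cst_continuous].
- move=> n x _; rewrite Re_smoothE //= normrM ger0_norm; last first.
    by rewrite invr_ge0 mulr_ge0 ?pi_ge0.
  rewrite ler_wpM2l ?invr_ge0 ?mulr_ge0 ?pi_ge0 //.
  have ia : mu.-integrable setT (EFin \o (fun w => abel n.+1%:R^-1 w * complex.Re (fourier g w * expj (x * w)))).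
    apply: (integrable_le_norm _ _ iM) => //.
    apply: measurable_funM; first exact: measurable_abel.
    exact: (cintegrable_cmeasurable (iFe x)).1.
  apply: le_trans (le_normr_Rintegral _ ia) _ => //.
  apply: le_Rintegral => //; exact: (integrable_abse ia).
Qed.

Let ae_Re_inversion g : cintegrable g -> cintegrable (fourier g) ->
  {ae mu, forall t, complex.Re (ifourier (fourier g) t) = complex.Re (g t)}.
Proof.
move=> ig iF.
have l1 : locally_integrable setT (fun t => complex.Re (ifourier (fourier g) t)).
  by apply: continuous_locally_integrable; have [] := continuous_ifourier iF.
have l2 : locally_integrable setT (fun t => complex.Re (g t)).
  by have [i1 _] := ig; exact: open_integrable_locally openT i1.
have := locally_integrable_ae_eq0 (locally_integrableB l1 l2).
move=> H.
have : {ae mu, forall t, complex.Re (ifourier (fourier g) t) - complex.Re (g t) = 0}.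
  apply: H => a b ab.
  rewrite RintegralB //; [|exact: locally_integrable_itv|exact: locally_integrable_itv].
  by rewrite Rintegral_itv_inversion // subrr.
apply: filterS; first exact: (ae_filter_ringOfSetsType mu).
by move=> t /= /eqP; rewrite subr_eq0 => /eqP.
Qed.

Lemma fourierZ (c : R[i]) h w : cintegrable h ->
  fourier (fun t => c * h t) w = c * fourier h w.
Proof.
move=> ih; rewrite /fourier -cintegralZ; last exact: cintegrable_fourier_integrand.
by apply: eq_cintegral => t; rewrite mulrA.
Qed.

Lemma cintegrableZ (c : R[i]) h : cintegrable h -> cintegrable (fun t => c * h t).
Proof.
move=> ih; under eq_fun do rewrite mulrC.
apply: (cintegrableM (C := cabs c)) => //; split; exact: measurable_cst.
Qed.

Lemma ifourierZ (c : R[i]) h t : cintegrable h ->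
  ifourier (fun w => c * h w) t = c * ifourier h t.
Proof. by move=> ih; rewrite /ifourier fourierZ // mulrCA. Qed.

Lemma Re_mulNi (z : R[i]) : complex.Re (- 'i%C * z) = complex.Im z.
Proof. by case: z => x y /=; rewrite !oppr0 mul0r mulN1r sub0r opprK. Qed.

(** The imaginary part of [g] is the real part of [- 'i * g], so linearity reduces it to the real
    case. *)
Lemma fourier_inversion g : cintegrable g -> cintegrable (fourier g) ->
  {ae mu, forall t, ifourier (fourier g) t = g t}.
Proof.
move=> ig iF; have aeRe := ae_Re_inversion ig iF.
have E : fourier (fun t => - 'i%C * g t) = fun w => - 'i%C * fourier g w.
  by apply/funext => w; rewrite fourierZ.
have := ae_Re_inversion (cintegrableZ (- 'i%C) ig).
rewrite E => /(_ (cintegrableZ _ iF)) aeIm.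
apply: (@filterS2 _ _ (ae_filter_ringOfSetsType mu) _ _ _ _ aeRe aeIm) => t h1 h2.
by apply: complex_ReIm => //; rewrite ifourierZ // !Re_mulNi in h2.
Qed.

End Inversion.

(** * Derivatives of inverse Fourier transforms *)

Section Derivatives.
Variable R : realType.
Implicit Types (h K : R -> R[i]) (t w x : R).
Let mu := @lebesgue_measure R.

(** Differentiation under the integral sign: the exponential is unimodular, so the [x]-derivative of
    the integrand is bounded by the modulus of ['i * w * K w], integrable and independent of [x]. *)
Lemma is_derive_Re_ifourier K t : cintegrable K ->
  cintegrable (fun w => 'i%C * w%:C * K w) ->
  is_derive t 1 (fun x => complex.Re (ifourier K x))
    (complex.Re (ifourier (fun w => 'i%C * w%:C * K w) t)).
Proof.
move=> iK iwK.
pose f x w := complex.Re (K w * expj (x * w)).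
pose df x w := complex.Re ('i%C * w%:C * K w * expj (x * w)).
have fd x w : is_derive x 1 (f ^~ w) (df x w).
  have dm : is_derive x 1 (fun y => y * w) w.
    by under eq_fun do rewrite mulrC; exact: is_derive_mull.
  have d1 : is_derive x 1 (cos \o (fun y => y * w)) (- sin (x * w) * w).
    exact: is_derive1_comp.
  have d2 : is_derive x 1 (sin \o (fun y => y * w)) (cos (x * w) * w).
    exact: is_derive1_comp.
  have := is_deriveB (is_deriveZ (complex.Re (K w)) d1) (is_deriveZ (complex.Im (K w)) d2).
  have -> : complex.Re (K w) \*: (cos \o *%R^~ w) - complex.Im (K w) \*: (sin \o *%R^~ w) = f ^~ w.
    by apply/funext => y; rewrite /f Re_mulc /= !fctE.
  move=> H; apply: (is_derive_eq H).
  by rewrite /df !Re_mulc !Im_mulc /= /GRing.scale /=; ring.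
pose I := `]t - 1, t + 1[%classic : set R.
have It : I t by rewrite /I /= in_itv /=; apply/andP; split; lra.
have intf x : I x -> mu.-integrable setT (EFin \o f x).
  move=> _; have [] // : cintegrable (fun w => K w * expj (x * w)).
  by apply: cintegrable_expj => //; exact: measurable_funM.
have der x w : I x -> setT w -> derivable (f ^~ w) x 1.
  by move=> _ _; exact: (@ex_derive _ _ _ _ _ _ _ (fd x w)).
have d1E x w : partial1of2 f x w = df x w.
  by rewrite /partial1of2 derive1E (@derive_val _ _ _ _ _ _ _ (fd x w)).
have ub x w : I x -> setT w -> `|partial1of2 f x w| <= cabs ('i%C * w%:C * K w).
  by move=> _ _; rewrite d1E (le_trans (ler_Re_cabs _)) // cabsM cabs_expj mulr1.
have D1 := derivable_under_integral measurableT It intf der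
  (fun w => cabs_ge0 _) (cintegrable_cabs iwK) ub.
have D2 := differentiation_under_integral measurableT It intf der
  (fun w => cabs_ge0 _) (cintegrable_cabs iwK) ub.
have D : is_derive t 1 (fun x => \int[mu]_w f x w) (\int[mu]_w df t w).
  apply: DeriveDef => //; rewrite -derive1E D2.
  by apply: eq_Rintegral => w _; rewrite d1E.
have := is_deriveZ (2 * pi)^-1 D.
have -> : (2 * pi)^-1 \*: (fun x => \int[mu]_w f x w) = fun x => complex.Re (ifourier K x).
  by apply/funext => x; rewrite Re_ifourierE.
by move=> H; apply: (is_derive_eq H); rewrite Re_ifourierE.
Qed.

Lemma is_derive_Im_ifourier K t : cintegrable K ->
  cintegrable (fun w => 'i%C * w%:C * K w) ->
  is_derive t 1 (fun x => complex.Im (ifourier K x))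
    (complex.Im (ifourier (fun w => 'i%C * w%:C * K w) t)).
Proof.
move=> iK iwK.
have E : (fun w => 'i%C * w%:C * (- 'i%C * K w)) = fun w => - 'i%C * ('i%C * w%:C * K w).
  by apply/funext => w; rewrite mulrCA.
have := @is_derive_Re_ifourier (fun w => - 'i%C * K w) t (cintegrableZ _ iK).
rewrite E => /(_ (cintegrableZ _ iwK)).
rewrite ifourierZ // Re_mulNi.
by under eq_fun do rewrite ifourierZ // Re_mulNi.
Qed.

(** The Fourier multiplier [(i w)^k] of the [k]-th derivative; keeping the power of [w] real reduces
    its modulus and continuity to real monomials. *)
Definition ipow (k : nat) w : R[i] := 'i%C ^+ k * (w ^+ k)%:C.

Lemma ipowS k w : ipow k.+1 w = 'i%C * w%:C * ipow k w.
Proof. by rewrite /ipow !exprS rmorphM mulrACA. Qed.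

Lemma cabs_ipow k w : cabs (ipow k w) = `|w| ^+ k.
Proof.
rewrite /ipow cabsM cabs_real normrX.
suff -> : cabs ('i%C ^+ k) = 1 :> R by rewrite mul1r.
elim: k => [|k IH]; first by rewrite expr0 cabs_real normr1.
by rewrite exprS cabsM IH mulr1 /cabs /= expr0n /= add0r expr1n sqrtr1.
Qed.

Lemma continuous_ipowM k h :
  continuous (fun w => complex.Re (h w)) -> continuous (fun w => complex.Im (h w)) ->
  continuous (fun w => complex.Re (ipow k w * h w)) /\
  continuous (fun w => complex.Im (ipow k w * h w)).
Proof.
move=> c1 c2; have cX := @exprn_continuous R k.
split=> w.
- have -> : (fun w => complex.Re (ipow k w * h w)) =
    fun w => complex.Re ('i%C ^+ k : R[i]) * (w ^+ k * complex.Re (h w)) -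
      complex.Im ('i%C ^+ k : R[i]) * (w ^+ k * complex.Im (h w)).
    by apply/funext => y; rewrite /ipow -mulrA Re_mulc Re_mulZ Im_mulZ.
  by apply: cvgB; (apply: cvgM; first exact: cvg_cst); apply: cvgM;
    [exact: cX|exact: c1|exact: cX|exact: c2].
- have -> : (fun w => complex.Im (ipow k w * h w)) =
    fun w => complex.Re ('i%C ^+ k : R[i]) * (w ^+ k * complex.Im (h w)) +
      complex.Im ('i%C ^+ k : R[i]) * (w ^+ k * complex.Re (h w)).
    by apply/funext => y; rewrite /ipow -mulrA Im_mulc Re_mulZ Im_mulZ.
  by apply: cvgD; (apply: cvgM; first exact: cvg_cst); apply: cvgM;
    [exact: cX|exact: c2|exact: cX|exact: c1].
Qed.

(** Intermediate moments are integrable because [|w| ^+ k <= 1 + |w| ^+ p], by the cases [|w| <= 1]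
    and [|w| > 1]. *)
Lemma cintegrable_ipow p k K : (k <= p)%N -> cintegrable K ->
  cintegrable (fun w => ipow p w * K w) -> cintegrable (fun w => ipow k w * K w).
Proof.
move=> kp iK ipK.
have := integrableD measurableT (cintegrable_cabs iK) (cintegrable_cabs ipK).
move/cmeasurable_cintegrable; apply.
- apply: cmeasM (cintegrable_cmeasurable iK); apply: cmeasM.
    by split; exact: measurable_cst.
  by apply: cmeas_real; exact: measurable_funX.
- move=> w; change (cabs (ipow k w * K w) <= cabs (K w) + cabs (ipow p w * K w)).
  rewrite (cabsM (ipow k w)) (cabsM (ipow p w)) !cabs_ipow.
  rewrite -[X in _ <= X + _]mul1r -mulrDl ler_wpM2r ?cabs_ge0 //.
  have [w1|w1] := leP `|w| 1.
    by rewrite (le_trans (exprn_ile1 _ _ w1)) // lerDl exprn_ge0.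
  by rewrite (le_trans (ler_weXn2l (ltW w1) kp)) // lerDr.
Qed.

Lemma derive1n_ifourier p K : cintegrable K ->
  cintegrable (fun w => ipow p w * K w) -> forall k, (k <= p)%N ->
  derive1n k (fun x => complex.Re (ifourier K x)) =
    (fun x => complex.Re (ifourier (fun w => ipow k w * K w) x)) /\
  derive1n k (fun x => complex.Im (ifourier K x)) =
    (fun x => complex.Im (ifourier (fun w => ipow k w * K w) x)).
Proof.
move=> iK ipK; elim=> [|k IH] kp.
  have -> : (fun w => ipow 0 w * K w) = K.
    by apply/funext => w; rewrite /ipow !expr0 !mul1r.
  by [].
have [IH1 IH2] := IH (ltnW kp).
have E : (fun w => ipow k.+1 w * K w) = fun w => 'i%C * w%:C * (ipow k w * K w).
  by apply/funext => w; rewrite ipowS mulrA.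
have ik := cintegrable_ipow (ltnW kp) iK ipK.
have ikS := cintegrable_ipow kp iK ipK; rewrite E in ikS.
rewrite !derive1nS IH1 IH2 E; split; apply/funext => x; rewrite derive1E.
- exact: (@derive_val _ _ _ _ _ _ _ (is_derive_Re_ifourier x ik ikS)).
- exact: (@derive_val _ _ _ _ _ _ _ (is_derive_Im_ifourier x ik ikS)).
Qed.

Lemma cderivable_n_ifourier p K : cintegrable K ->
  cintegrable (fun w => ipow p w * K w) -> cderivable_n p (ifourier K).
Proof.
move=> iK ipK k t kp.
have [-> ->] := derive1n_ifourier iK ipK (ltnW kp).
have E : (fun w => ipow k.+1 w * K w) = fun w => 'i%C * w%:C * (ipow k w * K w).
  by apply/funext => w; rewrite ipowS mulrA.
have ik := cintegrable_ipow (ltnW kp) iK ipK.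
have ikS := cintegrable_ipow kp iK ipK; rewrite E in ikS.
split.
- exact: (@ex_derive _ _ _ _ _ _ _ (is_derive_Re_ifourier t ik ikS)).
- exact: (@ex_derive _ _ _ _ _ _ _ (is_derive_Im_ifourier t ik ikS)).
Qed.

Lemma cderive_n_ifourier p K : cintegrable K ->
  cintegrable (fun w => ipow p w * K w) ->
  cderive_n p (ifourier K) =1 ifourier (fun w => ipow p w * K w).
Proof.
move=> iK ipK t; rewrite /cderive_n.
by have [-> ->] := derive1n_ifourier iK ipK (leqnn p); case: (ifourier _ _).
Qed.

(** Plancherel after the reflection [t |-> - t]; the squared normalisation [(2 * pi)^-1 ^+ 2] times
    [2 * pi] leaves [(2 * pi)^-1]. *)
Lemma integral_ifourier_sqr K : cintegrable K ->
  mu.-integrable setT (EFin \o (fun w => cabs (K w) ^+ 2)) ->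
  continuous (fun w => complex.Re (K w)) -> continuous (fun w => complex.Im (K w)) ->
  (\int[mu]_t (cabs (ifourier K t) ^+ 2)%:E =
   (2 * pi)^-1%:E * \int[mu]_w (cabs (K w) ^+ 2)%:E)%E.
Proof.
move=> iK iK2 c1 c2.
have sq (q : R) : 0 < q -> q^-1 ^+ 2 * q = q^-1.
  by move=> q0; rewrite expr2 -mulrA mulVf ?mulr1 ?gt_eqF.
have p0 : 0 < 2 * pi :> R by rewrite mulr_gt0 ?pi_gt0.
have mF := measurable_cabs_sqr (cmeasurable_fourier iK).
have N1 : -1 != 0 :> R by rewrite oppr_eq0 oner_eq0.
have E : (\int[mu]_t (cabs (fourier K (- t)) ^+ 2)%:E =
    \int[mu]_t (cabs (fourier K t) ^+ 2)%:E)%E.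
  rewrite [RHS](@ge0_integral_affine _ 0 (-1) _ N1) //; last 2 first.
  - exact/measurable_EFinP.
  - by move=> t; rewrite lee_fin sqr_ge0.
  by rewrite normrN1 mul1e; apply: eq_integral => t _; rewrite add0r mulN1r.
transitivity (\int[mu]_t (((2 * pi)^-1 ^+ 2)%:E * (cabs (fourier K (- t)) ^+ 2)%:E))%E.
  apply: eq_integral => t _; rewrite -EFinM; congr EFin.
  by rewrite /ifourier cabsM cabs_real exprMn ger0_norm ?invr_ge0 ?(ltW p0).
have Zl (c : R) : 0 <= c -> (\int[mu]_t (c%:E * (cabs (fourier K (- t)) ^+ 2)%:E) =
    c%:E * \int[mu]_t (cabs (fourier K (- t)) ^+ 2)%:E)%E.
  move=> c0.
  have mN : measurable_fun [set: measurableTypeR R]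
      (fun t => (cabs (fourier K (- t)) ^+ 2)%:E).
    by apply/measurable_EFinP; exact: (measurableT_comp mF (@oppr_measurable R setT)).
  have N0 t : setT t -> (0 <= (cabs (fourier K (- t)) ^+ 2)%:E)%E.
    by move=> _; rewrite lee_fin sqr_ge0.
  rewrite -lee_fin in c0.
  exact: (@ge0_integralZl _ _ _ mu setT measurableT _ mN c%:E N0 c0).
rewrite (Zl _ (sqr_ge0 _)) E (plancherel iK iK2 c1 c2) muleA -EFinM.
by rewrite (sq _ p0).
Qed.

End Derivatives.

(** * The offset linear canonical transform *)

Section Offset.
Variable R : realType.
Implicit Types (f F : R -> R[i]) (a b c d tau eta t w xi : R).
Let mu := @lebesgue_measure R.

Lemma cLp1_cintegrable F : cLp 1%:E F -> cintegrable F.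
Proof.
move=> [mF]; rewrite /finite_norm Lnorm1 => nF.
apply: (cmeasurable_cintegrable (u := fun t => cabs (F t)) mF) => //.
by apply/integrableP; split => //; apply/measurable_EFinP; exact: measurable_cabs.
Qed.

Lemma cLp2_integrable F : cLp 2%:E F ->
  mu.-integrable setT (EFin \o (fun t => cabs (F t) ^+ 2)).
Proof.
move=> [mF nF]; apply/integrableP; split.
  by apply/measurable_EFinP; exact: measurable_cabs_sqr.
have := poweR_lty 2 nF; rewrite poweR_Lnorm // => H.
rewrite (_ : (\int[_]_x _)%E = (\int[mu]_x (`|(EFin \o (fun t => cabs (F t))) x| `^ 2))%E) //.
apply: eq_integral => t _; rewrite /= powR_mulrn ?normr_ge0 //.
by rewrite normrX.
Qed.

Lemma integrable_affine (m b : R) (u : R -> R) : b != 0 -> (forall x, 0 <= u x) ->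
  mu.-integrable setT (EFin \o u) ->
  mu.-integrable setT (EFin \o (fun w => u (m + b * w))).
Proof.
move=> b0 u0 /integrableP[mu_ iu].
have mub : measurable_fun [set: measurableTypeR R] (fun w => (u (m + b * w))%:E).
  exact: (measurableT_comp mu_ (measurable_affine m b)).
apply/integrableP; split => //.
under eq_integral do rewrite /= ger0_norm //.
have bV : b^-1 != 0 by rewrite invr_eq0.
(* Substituting the inverse affine map brings back the integral of [u] itself. *)
rewrite (@ge0_integral_affine _ (- (m / b)) b^-1 _ bV mub); last first.
  by move=> x; rewrite lee_fin.
under eq_integral => x _.
  rewrite (_ : m + b * (- (m / b) + b^-1 * x) = x); last by field.
  over.
under eq_integral => x _ do rewrite -(ger0_norm (u0 x)).
by apply: lte_mul_pinfty.
Qed.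

Lemma cintegrable_gbeta a b beta f : cintegrable f -> cintegrable (gbeta a b beta f).
Proof.
move=> intf; rewrite /gbeta; under eq_fun do rewrite mulrC -expjD.
apply: cintegrable_expj => //; apply: measurable_funD.
  by apply: measurableT_comp => //; exact: measurable_funM.
by apply: measurable_funM => //; exact: measurable_funX.
Qed.

(** At [xi = xi_m + b * w] the cross term [b^-1 * t * (xi - tau)] splits as
    [t * ((xi_m - tau) / b) + t * w]: the first part is the modulation in [gbeta], the second the
    Fourier kernel. *)
Lemma olct_affine a b c d tau eta f xi_m w : b != 0 -> cintegrable f ->
  exists theta : R, olct a b c d tau eta f (xi_m + b * w) =
    (sqrtc ('i%C * (2 * pi * b)%:C))^-1 * expj theta *
    fourier (gbeta a b ((xi_m - tau) / b) f) w.
Proof.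
move=> b0 intf; pose xi := xi_m + b * w.
(* The terms of the kernel's phase that do not depend on [t]. *)
exists (d / (2 * b) * (xi ^+ 2 + tau ^+ 2) - b^-1 * xi * (d * tau - b * eta)).
rewrite /fourier -cintegralZ; last first.
  exact/cintegrable_fourier_integrand/cintegrable_gbeta.
apply: eq_cintegral => t; rewrite /olct_kernel /gbeta -/xi.
rewrite [LHS]mulrCA -[RHS]mulrA; congr (_ * _).
rewrite -!mulrA [f t * expj (- (w * t))]mulrC !mulrA -!expjD mulrC.
congr (expj _ * _); rewrite /xi; field; exact: b0.
Qed.

(** A square root of [z] has squared modulus [cabs z], here [2 * pi * |b|]. The factor [|b|]
    anticipates the Jacobian of [xi = xi_m + b * w]. *)
Lemma cabs_sqrtc_inv b : b != 0 ->
  0 < cabs (sqrtc ('i%C * (2 * pi * b)%:C))^-1 /\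
  `|b| * cabs (sqrtc ('i%C * (2 * pi * b)%:C))^-1 ^+ 2 = (2 * pi)^-1.
Proof.
have p0 : 0 < 2 * pi :> R by rewrite mulr_gt0 ?pi_gt0.
move: (2 * pi) p0 => q q0 b0.
have E : cabs (sqrtc ('i%C * (q * b)%:C)) ^+ 2 = q * `|b|.
  rewrite expr2 -cabsM -expr2 sqr_sqrtc cabsM cabs_real normrM (gtr0_norm q0).
  by rewrite /cabs /= expr0n /= add0r expr1n sqrtr1 mul1r.
have nb : 0 < `|b| by rewrite normr_gt0.
have c0 : 0 < cabs (sqrtc ('i%C * (q * b)%:C)).
  rewrite lt_neqAle cabs_ge0 andbT eq_sym; apply/negP => /eqP z.
  by move: E; rewrite z expr0n /= => /esym/eqP; rewrite mulf_eq0 !gt_eqF.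
rewrite /cabs ComplexField.Normc.normcV -/(cabs _) invr_gt0 c0; split=> //.
by rewrite exprVn E; field; rewrite !gt_eqF.
Qed.

End Offset.

(** For [p = 0] two versions agree almost everywhere, which suffices for the integrals. For [p > 0]
    they are differentiable, hence continuous, so they agree everywhere and have the same
    derivatives. *)
Lemma derivable_version_integral (R : realType) (p : nat) (F G H : R -> R[i]) :
  derivable_version p F G -> derivable_version p F H ->
  (\int[lebesgue_measure]_t (cabs (cderive_n p G t) ^+ 2)%:E =
   \int[lebesgue_measure]_t (cabs (cderive_n p H t) ^+ 2)%:E)%E.
Proof.
move=> [mG aeG dG] [mH aeH dH].
have aeGH : {ae @lebesgue_measure R, forall t, G t = H t}.
  by apply: (@filterS2 _ _ (ae_filter_ringOfSetsType _) _ _ _ _ aeG aeH) => t -> ->.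
case: p dG dH => [_ _|p dG dH].
  have E (K : R -> R[i]) t : cderive_n 0 K t = K t by rewrite /cderive_n /=; case: (K t).
  under eq_integral do rewrite E.
  under [RHS]eq_integral do rewrite E.
  apply: ae_eq_integral => //.
  - by apply/measurable_EFinP; exact: measurable_cabs_sqr.
  - by apply/measurable_EFinP; exact: measurable_cabs_sqr.
  - apply: (@filterS _ _ (ae_filter_ringOfSetsType _) _ _ _ aeGH).
    by move=> t E1 _; rewrite E1.
have cont (K : R -> R[i]) : cderivable_n p.+1 K ->
    continuous (fun t => complex.Re (K t)) /\ continuous (fun t => complex.Im (K t)).
  move=> dK; split => t; apply/differentiable_continuous/derivable1_diffP.
  - exact: (dK 0%N t (ltn0Sn p)).1.
  - exact: (dK 0%N t (ltn0Sn p)).2.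
have [G1 G2] := cont G dG; have [H1 H2] := cont H dH.
have EqRe := continuous_ae_eq G1 H1; have EqIm := continuous_ae_eq G2 H2.
have F' := ae_filter_ringOfSetsType (@lebesgue_measure R).
rewrite /cderive_n EqRe ?EqIm //.
- by apply: (@filterS _ _ F' _ _ _ aeGH) => t ->.
- by apply: (@filterS _ _ F' _ _ _ aeGH) => t ->.
Qed.

Theorem theorem1 (R : realType) (a b c d tau eta xi_m : R)
    (hdet : a * d - b * c = 1) (hb : b != 0)
    (f : R -> R[i]) (p : nat)
    (hf : cL1L2 f)
    (hO : cL1L2 (olct a b c d tau eta f))
    (hpO : cL1L2 (fun xi : R =>
       ((xi - xi_m) ^+ p)%:C * olct a b c d tau eta f xi)) :
  let sigma_m : R := (xi_m - tau) / (2 * pi * b) in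
  let beta : R := 2 * pi * sigma_m in
  (exists G : R -> R[i], derivable_version p (gbeta a b beta f) G) /\
  (forall G : R -> R[i], derivable_version p (gbeta a b beta f) G ->
    (\int[lebesgue_measure]_(xi in [set: R])
       ((xi - xi_m) ^+ (2 * p) *
        cabs (olct a b c d tau eta f xi) ^+ 2)%:E
     = (b ^+ (2 * p))%:E *
       \int[lebesgue_measure]_(t in [set: R])
         (cabs (cderive_n p G t) ^+ 2)%:E)%E).
Proof.
move=> sigma_m beta.
have betaE : beta = (xi_m - tau) / b.
  rewrite /beta /sigma_m; have : 0 < 2 * pi :> R by rewrite mulr_gt0 ?pi_gt0.
  by move: (2 * pi) => q q0; field; rewrite hb gt_eqF.
have intf := cLp1_cintegrable hf.1.
pose g := gbeta a b beta f; pose F := fourier g.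
pose O := olct a b c d tau eta f.
have ig : cintegrable g by exact: cintegrable_gbeta.
have mF : cmeasurable F by exact: cmeasurable_fourier.
have [k0 kE] := cabs_sqrtc_inv hb.
set k : R := cabs _ in k0 kE.
have OF w : cabs (O (xi_m + b * w)) = k * cabs (F w).
  have [theta] := olct_affine a c d tau eta xi_m w hb intf.
  by rewrite -betaE => E; rewrite /O E !cabsM cabs_expj mulr1.
have iF : cintegrable F.
  (* By [OF], [cabs (F w)] is [k^-1 * cabs (O (xi_m + b * w))], so integrability passes from [O] to
     [F]. *)
  have := integrable_affine xi_m hb (fun x => cabs_ge0 (O x)) (cintegrable_cabs (cLp1_cintegrable hO.1)).
  move/(integrableZ_real k^-1)/(cmeasurable_cintegrable mF); apply.
  by move=> w; rewrite OF mulKf ?gt_eqF.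
(* The inverse transform of [K] will be the [p]-th derivative of [ifourier F]. *)
pose K w := ipow p w * F w.
have mK : cmeasurable K.
  apply: cmeasM mF; apply: cmeasM; first by split; exact: measurable_cst.
  by apply: cmeas_real; exact: measurable_funX.
pose P xi : R[i] := ((xi - xi_m) ^+ p)%:C * O xi.
have bp0 : 0 < `|b| ^+ p * k by rewrite mulr_gt0 // exprn_gt0 // normr_gt0.
have PK w : cabs (P (xi_m + b * w)) = `|b| ^+ p * k * cabs (K w).
  rewrite /P /K (cabsM (ipow p w)) cabs_ipow cabsM OF cabs_real addrAC subrr add0r.
  by rewrite normrX normrM exprMn; ring.
have iK : cintegrable K.
  have := integrable_affine xi_m hb (fun x => cabs_ge0 (P x)) (cintegrable_cabs (cLp1_cintegrable hpO.1)).
  move/(integrableZ_real (`|b| ^+ p * k)^-1)/(cmeasurable_cintegrable mK); apply.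
  by move=> w; rewrite PK mulKf ?gt_eqF.
have iK2 : (@lebesgue_measure R).-integrable setT (EFin \o (fun w => cabs (K w) ^+ 2)).
  have -> : (fun w => cabs (K w) ^+ 2) =
      fun w => ((`|b| ^+ p * k) ^+ 2)^-1 * cabs (P (xi_m + b * w)) ^+ 2.
    by apply/funext => w; rewrite PK [(_ * cabs (K w)) ^+ 2]exprMn mulKf // expf_neq0 ?gt_eqF.
  apply: integrableZ_real.
  exact: (integrable_affine xi_m hb (fun x => sqr_ge0 (cabs (P x))) (cLp2_integrable hpO.2)).
have dG : derivable_version p g (ifourier F).
  have [c1 c2] := continuous_ifourier iF.
  split; [|exact: fourier_inversion|exact: cderivable_n_ifourier].
  by split; exact: continuous_measurable_fun.
split; first by exists (ifourier F).
(* Every version gives the same right-hand side, so the computation is done for [ifourier F]. *)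
move=> G hG; rewrite (derivable_version_integral hG dG).
under [in RHS]eq_integral do rewrite cderive_n_ifourier //.
have [cF1 cF2] := continuous_fourier ig.
(* Plancherel is applied to [K], which is continuous because [F] is the transform of an integrable
   function. *)
have [cK1 cK2] := continuous_ipowM p cF1 cF2.
rewrite (integral_ifourier_sqr iK iK2 cK1 cK2) -(EFin_Rintegral iK2) -!EFinM.
have mO := measurable_cabs_sqr hO.1.1.
rewrite (@ge0_integral_affine _ xi_m b _ hb); last 2 first.
- apply/measurable_EFinP; apply: measurable_funM => //; apply: measurable_funX.
  exact: measurable_funB.
- by move=> xi; rewrite lee_fin mulr_ge0 ?sqr_ge0 // exprM exprn_ge0 ?sqr_ge0.
have E w : ((xi_m + b * w - xi_m) ^+ (2 * p) * cabs (O (xi_m + b * w)) ^+ 2)%:E =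
    (b ^+ (2 * p) * k ^+ 2 * cabs (K w) ^+ 2)%:E.
  congr EFin; rewrite OF /K (cabsM (ipow p w)) cabs_ipow addrAC subrr add0r.
  rewrite !exprMn -exprM [(p * 2)%N]mulnC exprM [`|w| ^+ (2 * p)]exprM real_normK ?num_real //.
  by rewrite !exprM; ring.
transitivity (`|b|%:E * \int[lebesgue_measure]_w
    (b ^+ (2 * p) * k ^+ 2 * cabs (K w) ^+ 2)%:E)%E.
  by congr (_ * _)%E; apply: eq_integral => w _; exact: E.
rewrite -EFin_Rintegral; last exact: integrableZ_real.
(* By [kE] the Jacobian [|b|] and [k ^+ 2] multiply to the Plancherel constant [(2 * pi)^-1],
   leaving [b ^+ (2 * p)]. *)
rewrite RintegralZl // -EFinM; congr EFin; rewrite -kE; ring.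
Qed.
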